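(* Let $R$ be a principal ideal domain and let $(G,w)$, $(G',w')$ be weighted digraphs with non-vanishing weights in $R$ and disjoint vertex sets. For each $r\ge0$ there is a natural short exact sequence $$0\to\bigoplus_{p,q\ge-1,\ p+q=r-1}\big(H_p(G,w;R)\otimes H_q(G',w';R)\big)\to H_r(G*G',w*w';R)\to\bigoplus_{p,q\ge-1,\ p+q=r-1}\mathrm{Tor}_R\big(H_p(G,w;R),H_{q-1}(G',w';R)\big)\to0$$ and this sequence splits.
   Context: A digraph $G=(V,E)$ consists of a finite nonempty set $V$ and a set $E$ of ordered pairs $(u,v)\in V\times V$ with $u\ne v$; write $u\to v$ for $(u,v)\in E$. A weight on $G$ is a function $w:V\to R$; it is non-vanishing if $w(i)\neq 0$ for all $i\in V$. The pair $(G,w)$ is a weighted digraph. For $p\ge 0$, $\Lambda_p(V)$ is the free $R$-module on all sequences (elementary $p$-paths) $e_{i_0\cdots i_p}$, $i_k\in V$; $\Lambda_{-1}(V)=R$ (generated by the empty path). An elementary path is regular if $i_k\ne i_{k+1}$ for all $k$, otherwise non-regular. $\mathcal R_p(V)$ and $\mathcal I_p(V)$ are the submodules of $\Lambda_p(V)$ generated by the regular, resp. non-regular, elementary $p$-paths, and $\mathcal R_p(V)\cong\Lambda_p(V)/\mathcal I_p(V)$. The weighted boundary operator is $\partial^w e_{i_0\cdots i_p}=\sum_{q=0}^p(-1)^q w(i_q)\,e_{i_0\cdots\widehat{i_q}\cdots i_p}$, extended linearly; it induces $\partial^w:\mathcal R_p(V)\to\mathcal R_{p-1}(V)$ through this isomorphism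 (i.e. non-regular terms are set to $0$), with $\partial^w\partial^w=0$. An elementary path $e_{i_0\cdots i_p}$ is allowed on $G$ if $i_{k-1}\to i_k$ for all $k=1,\dots,p$. $\mathcal A_p(G)\subseteq\mathcal R_p(V)$ is the submodule generated by allowed elementary $p$-paths ($\mathcal A_{-1}(G)=R$). Put $\Omega^w_p(G)=\{v\in\mathcal A_p(G):\partial^w v\in\mathcal A_{p-1}(G)\}$; these form a chain complex $\cdots\to\Omega^w_1(G)\to\Omega^w_0(G)\to R\to0$ under $\partial^w$. The weighted path homology $H_p(G,w;R)$ is the $p$-th homology of the truncated complex $\cdots\to\Omega^w_1(G)\to\Omega^w_0(G)\to0$, in which $\Omega^w_0(G)\to R$ is replaced by $\Omega^w_0(G)\to 0$; it is defined for $p\ge0$, and the truncated complex has no homology in negative degrees. Tensor products are over $R$. Join: for weighted digraphs $(G,w)$, $(G',w')$, with $G=(V,E)$, $G'=(V',E')$ and $V\cap V'=\emptyset$, the weighted digraph $(G*G',w*w')$ has vertex set $V\sqcup V'$, edge set $E\sqcup E'\sqcup\{(i,j): i\in V,\ j\in V'\}$, and weight equal to $w$ on $V$ and $w'$ on $V'$.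
   Formalization: H_p is the homology of the augmented complex ...→Ω_1→Ω_0→R→0 (so H_{-1}=R/(weights)), not of the truncated one, with which the sequence always fails at r=0; naturality is for weight-preserving vertex maps sending each edge to an edge or a vertex. *)

(* Defs.v *)
From HB Require Import structures.
From mathcomp Require Import multinomials.freeg.
From mathcomp Require Import all_boot all_order all_algebra generic_quotient.
From mathcomp Require Import boolp.

Set Implicit Arguments.
Unset Strict Implicit.
Unset Printing Implicit Defensive.

Import GRing.Theory.

Local Open Scope ring_scope.
Local Open Scope quotient_scope.

Section Submodules.
Variables (R : comNzRingType) (V : lmodType R) (S : submodClosed V).

Inductive submod : predArgType := Submod u & u \in S.

Definition submod_val w : V := let: Submod u _ := w in u.

HB.instance Definition _ := [isSub of submod for submod_val].
HB.instance Definition _ := [Choice of submod by <:].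
HB.instance Definition _ := [SubChoice_isSubLmodule of submod by <:].
End Submodules.


Section Quotients.
Variables (R : comNzRingType) (V : lmodType R) (S : submodClosed V).

Definition submod_zmod : {pred V} := fun x => x \in S.

Fact submod_zmod_closed : zmod_closed submod_zmod.
Proof. exact: (GRing.submod_closedB (GRing.submodClosedP S)). Qed.

HB.instance Definition _ :=
  GRing.isZmodClosed.Build V submod_zmod submod_zmod_closed.

Definition quomod : Type := Quotient.quot submod_zmod.

HB.instance Definition _ := GRing.Zmodule.on quomod.
HB.instance Definition _ := EqQuotient.on quomod.

Definition quo (x : V) : quomod := \pi_quomod x.

Lemma quo_eqP x y : quo x = quo y <-> x - y \in S.
Proof.
by split=> [/eqP|h]; last apply/eqP; rewrite -Quotient.idealrBE.
Qed.

Lemma quo_eq0 x : quo x = 0 <-> x \in S.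
Proof.
have -> : 0 = quo 0 by rewrite /quo pi_zeror.
by rewrite quo_eqP subr0.
Qed.

Lemma quoK (q : quomod) : quo (repr q) = q.
Proof. exact: reprK. Qed.

Lemma quoD : {morph quo : x y / x + y}.
Proof. by move=> x y; rewrite /quo pi_addr. Qed.

Definition quo_scale (a : R) (q : quomod) : quomod := quo (a *: repr q).

Lemma quo_scaleE a x : quo_scale a (quo x) = quo (a *: x).
Proof. by apply/quo_eqP; rewrite -scalerBr rpredZ //; apply/quo_eqP/quoK. Qed.

Fact quo_scaleA a b q : quo_scale a (quo_scale b q) = quo_scale (a * b) q.
Proof. by rewrite -[q]quoK !quo_scaleE scalerA. Qed.

Fact quo_scale1 : left_id 1 quo_scale.
Proof. by move=> q; rewrite -[q in LHS]quoK quo_scaleE scale1r quoK. Qed.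

Fact quo_scaleDr : right_distributive quo_scale +%R.
Proof.
by move=> a p q; rewrite -[p]quoK -[q]quoK -quoD !quo_scaleE scalerDr quoD.
Qed.

Fact quo_scaleDl q : {morph quo_scale^~ q : a b / a + b}.
Proof. by move=> a b; rewrite -[q]quoK !quo_scaleE scalerDl quoD. Qed.

HB.instance Definition _ := GRing.Zmodule_isLmodule.Build R quomod
  quo_scaleA quo_scale1 quo_scaleDr quo_scaleDl.

Fact quo_is_linear : linear quo.
Proof. by move=> a x y; rewrite quoD -quo_scaleE. Qed.

HB.instance Definition _ := GRing.isLinear.Build R V quomod *:%R quo quo_is_linear.

End Quotients.

Section InducedMaps.
Variables (R : comNzRingType) (V W : lmodType R).
Variables (S : submodClosed V) (T : submodClosed W) (f : {linear V -> W}).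

Section Sub.
Hypothesis fST : {in S, forall x, f x \in T}.

Definition submod_map (x : submod S) : submod T := Submod (fST (valP x)).

Fact submod_map_is_linear : linear submod_map.
Proof. by move=> a x y; apply: val_inj; rewrite /= linearP. Qed.

HB.instance Definition _ := GRing.isLinear.Build R (submod S) (submod T) *:%R
  submod_map submod_map_is_linear.
End Sub.

Section QuoLift.
Hypothesis fS0 : {in S, forall x, f x = 0}.

Definition quo_lift of {in S, forall x, f x = 0} :=
  fun q : quomod S => f (repr q).

Lemma quo_liftE x : quo_lift fS0 (quo S x) = f x.
Proof.
apply/eqP; rewrite -subr_eq0 -linearB; apply/eqP/fS0/quo_eqP.
exact: quoK.
Qed.

Fact quo_lift_is_linear : linear (quo_lift fS0).
Proof.
by move=> a p q; rewrite -[p]quoK -[q]quoK -linearP !quo_liftE linearP.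
Qed.

HB.instance Definition _ := GRing.isLinear.Build R (quomod S) W *:%R
  (quo_lift fS0) quo_lift_is_linear.
End QuoLift.

End InducedMaps.

Section QuoMap.
Variables (R : comNzRingType) (V W : lmodType R).
Variables (S : submodClosed V) (T : submodClosed W) (f : {linear V -> W}).
Hypothesis fST : {in S, forall x, f x \in T}.

Fact quo_map_subproof : {in S, forall x, (quo T \o f) x = 0}.
Proof. by move=> x /fST fx; apply/quo_eq0. Qed.

Definition quo_map : {linear quomod S -> quomod T} := quo_lift quo_map_subproof.

Lemma quo_mapE x : quo_map (quo S x) = quo T (f x).
Proof. exact: quo_liftE. Qed.
End QuoMap.

Section Predicates.
Variables (R : comNzRingType) (V W : lmodType R).

Definition ker_pred (f : {linear V -> W}) : {pred V} := fun x => f x == 0.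

Fact ker_pred_closed f : submod_closed (ker_pred f).
Proof.
split=> [|a x y /eqP fx /eqP fy]; rewrite unfold_in ?linear0 //.
by rewrite linearP fx fy scaler0 addr0.
Qed.

HB.instance Definition _ f :=
  GRing.isSubmodClosed.Build R V (ker_pred f) (ker_pred_closed f).

Definition im_pred (f : {linear V -> W}) : {pred W} :=
  fun y => `[< exists x, f x = y >].

Fact im_pred_closed f : submod_closed (im_pred f).
Proof.
split=> [|a x y /asboolP[u <-] /asboolP[v <-]]; apply/asboolP.
  by exists 0; rewrite linear0.
by exists (a *: u + v); rewrite linearP.
Qed.

HB.instance Definition _ f :=
  GRing.isSubmodClosed.Build R W (im_pred f) (im_pred_closed f).

Definition span_pred (X : V -> Prop) : {pred V} := fun x =>
  `[< forall S : submodClosed V, (forall y, X y -> y \in S) -> x \in S >].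

Fact span_pred_closed X : submod_closed (span_pred X).
Proof.
split=> [|a x y /asboolP hx /asboolP hy]; apply/asboolP => S hS.
  exact: rpred0.
by rewrite rpredD ?rpredZ ?hx ?hy.
Qed.

HB.instance Definition _ X :=
  GRing.isSubmodClosed.Build R V (span_pred X) (span_pred_closed X).

Lemma span_gen (X : V -> Prop) x : X x -> x \in span_pred X.
Proof. by move=> Xx; apply/asboolP => S; apply. Qed.

Lemma span_sub (X : V -> Prop) (S : submodClosed V) :
  (forall y, X y -> y \in S) -> {subset span_pred X <= S}.
Proof. by move=> XS x /asboolP; apply. Qed.
End Predicates.

Section FreeModules.
Variable R : comNzRingType.

Definition free_gen (K : choiceType) (k : K) : {freeg K / R} := << k >>.

Section Lift.
Variables (K : choiceType) (M : lmodType R) (f : K -> M).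

Fact fglift_is_linear : linear (fglift f : {freeg K / R} -> M).
Proof.
have fgB : {morph (fglift f : {freeg K / R} -> M) : x y / x - y >-> x - y}.
  exact: lift_is_additive.
have fg0 : fglift f (0 : {freeg K / R}) = 0.
  by rewrite -[in LHS](subrr 0) fgB subrr.
have fgN x : fglift f (- x : {freeg K / R}) = - fglift f x.
  by rewrite -[in LHS](sub0r x) fgB fg0 sub0r.
have fgD x y : fglift f (x + y : {freeg K / R}) = fglift f x + fglift f y.
  by rewrite -[in LHS](opprK y) fgB fgN opprK.
have fgsum (s : seq K) (F : K -> {freeg K / R}) :
    fglift f (\sum_(x <- s) F x) = \sum_(x <- s) fglift f (F x).
  by elim: s => [|x s IH]; rewrite ?big_nil ?big_cons ?fg0 ?fgD ?IH.
move=> a x y; rewrite fgD; congr (_ + _).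
rewrite [a *: x]/GRing.scale /= /fgscale -{3}[x]freeg_sumE !fgsum scaler_sumr.
by apply: eq_bigr => k _; rewrite !liftU scalerA.
Qed.

HB.instance Definition _ := GRing.isLinear.Build R {freeg K / R} M *:%R
  (fglift f) fglift_is_linear.

Definition free_lift : {linear {freeg K / R} -> M} := fglift f.

Lemma free_liftE k : free_lift (free_gen k) = f k.
Proof. by rewrite /free_lift /= liftU scale1r. Qed.
End Lift.

Lemma free_ext (K : choiceType) (M : lmodType R)
    (f g : {linear {freeg K / R} -> M}) :
  (forall k, f (free_gen k) = g (free_gen k)) -> f =1 g.
Proof.
move=> fg x; rewrite -[x]freeg_sumE !linear_sum; apply: eq_bigr => k _.
have -> : << coeff k x *g k >> = coeff k x *: free_gen k :> {freeg K / R}.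
  by apply/eqP/freeg_eqP => j; rewrite coeffZ !coeffU mul1r.
by rewrite !linearZ_LR fg.
Qed.

Definition free_map (K L : choiceType) (f : K -> L) :
    {linear {freeg K / R} -> {freeg L / R}} :=
  free_lift (fun k => free_gen (f k)).

Lemma free_mapE (K L : choiceType) (f : K -> L) k :
  free_map f (free_gen k) = free_gen (f k).
Proof. exact: free_liftE. Qed.
End FreeModules.

Arguments free_gen R {K} k.

Section Tensor.
Variable R : comNzRingType.

Section Def.
Variables M N : lmodType R.

Local Notation e x y := (free_gen R (x : M, y : N)).

Inductive bilinear_rel : {freeg (M * N)%type / R} -> Prop :=
| BilinDl x x' y : bilinear_rel (e (x + x') y - (e x y + e x' y))
| BilinDr x y y' : bilinear_rel (e x (y + y') - (e x y + e x y'))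
| BilinZl a x y : bilinear_rel (e (a *: x) y - a *: e x y)
| BilinZr a x y : bilinear_rel (e x (a *: y) - a *: e x y).

Definition tensor : lmodType R := quomod (span_pred bilinear_rel).

Definition tens (x : M) (y : N) : tensor := quo _ (free_gen R (x, y)).
End Def.

Lemma tensor_ext (M N : lmodType R) (P : lmodType R)
    (f g : {linear tensor M N -> P}) :
  (forall x y, f (tens x y) = g (tens x y)) -> f =1 g.
Proof.
move=> fg q; rewrite -[q]quoK.
have fg' : (f \o quo (span_pred (@bilinear_rel M N)))
   =1 (g \o quo (span_pred (@bilinear_rel M N))).
  by apply: free_ext => -[x y]; apply: fg.
exact: fg'.
Qed.

Section Map.
Variables (M N M' N' : lmodType R).
Variables (f : {linear M -> M'}) (g : {linear N -> N'}).

Fact tensor_map_subproof :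
  {in span_pred (@bilinear_rel M N), forall x,
    free_map R (fun p => (f p.1, g p.2)) x \in span_pred (@bilinear_rel M' N')}.
Proof.
set h := free_map _ _ => x /asboolP hx.
pose S := ker_pred (quo (span_pred (@bilinear_rel M' N')) \o h).
have : x \in S.
  have hE u v : h (free_gen R (u, v)) = free_gen R (f u, g v).
    exact: free_mapE.
  have hD u v : h (u + v) = h u + h v by exact: linearD.
  have hB u v : h (u - v) = h u - h v by exact: linearB.
  have hZ a u : h (a *: u) = a *: h u by exact: linearZ_LR.
  have hS y : h y \in span_pred (@bilinear_rel M' N') -> y \in S.
    by move=> hy; apply/eqP/quo_eq0.
  apply: hx => y; case=> [u u' v|u v v'|a u v|a u v]; apply: hS.
  - by rewrite hB hD !hE (linearD f); apply/span_gen/BilinDl.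
  - by rewrite hB hD !hE (linearD g); apply/span_gen/BilinDr.
  - by rewrite hB hZ !hE (linearZ_LR f); apply/span_gen/BilinZl.
  - by rewrite hB hZ !hE (linearZ_LR g); apply/span_gen/BilinZr.
by move=> /eqP/quo_eq0.
Qed.

Definition tensor_map : {linear tensor M N -> tensor M' N'} :=
  quo_map tensor_map_subproof.

Lemma tensor_mapE x y : tensor_map (tens x y) = tens (f x) (g y).
Proof. by rewrite /tensor_map quo_mapE free_mapE. Qed.
End Map.

Lemma tensor_map_square (M N M1 N1 M2 N2 P Q : lmodType R)
    (f1 : {linear M1 -> P}) (g1 : {linear N1 -> Q})
    (f2 : {linear M -> M1}) (g2 : {linear N -> N1})
    (f1' : {linear M2 -> P}) (g1' : {linear N2 -> Q})
    (f2' : {linear M -> M2}) (g2' : {linear N -> N2}) :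
    f1 \o f2 =1 f1' \o f2' -> g1 \o g2 =1 g1' \o g2' ->
  forall z, tensor_map f1 g1 (tensor_map f2 g2 z)
            = tensor_map f1' g1' (tensor_map f2' g2' z).
Proof.
move=> ff gg z.
have E : tensor_map f1 g1 \o tensor_map f2 g2
         =1 tensor_map f1' g1' \o tensor_map f2' g2'.
  apply: tensor_ext => x y.
  rewrite -[LHS]/(tensor_map f1 g1 (tensor_map f2 g2 (tens x y))).
  rewrite -[RHS]/(tensor_map f1' g1' (tensor_map f2' g2' (tens x y))).
  rewrite !tensor_mapE; congr tens; [exact: ff | exact: gg].
exact: E.
Qed.
End Tensor.

Arguments tensor_map : simpl never.

Section Tor.
Variable R : comNzRingType.

Definition lin_id (M : lmodType R) : {linear M -> M} := idfun.

(* Tor_1(M, N), computed from the canonical presentation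
   0 -> syzygy M -> {freeg M / R} -> M -> 0 of M by the free module on the
   underlying set of M. Over a PID submodules of free modules are free, so this
   is a free resolution of M, and Tor_R(M, N) is the kernel of
   syzygy M (x) N -> {freeg M / R} (x) N. *)
Definition free_cover (M : lmodType R) : {linear {freeg M / R} -> M} :=
  free_lift (fun x : M => x).

Definition syzygy (M : lmodType R) : lmodType R := submod (ker_pred (free_cover M)).

Definition submod_incl (V : lmodType R) (S : submodClosed V) :
    {linear submod S -> V} := val.

Definition syzygy_incl (M : lmodType R) : {linear syzygy M -> {freeg M / R}} :=
  submod_incl _.

Definition Tor (M N : lmodType R) : lmodType R := 
  submod (ker_pred (tensor_map (syzygy_incl M) (lin_id N))).

Section Map.
Variables (M N M' N' : lmodType R).
Variables (f : {linear M -> M'}) (g : {linear N -> N'}).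

Fact syzygy_map_subproof :
  {in ker_pred (free_cover M), forall x,
    free_map R f x \in ker_pred (free_cover M')}.
Proof.
move=> x /eqP hx; apply/eqP.
have E : (free_cover M' \o free_map R f) =1 (f \o free_cover M).
  by apply: free_ext => k /=; rewrite free_mapE !free_liftE.
by rewrite -[LHS]/((free_cover M' \o free_map R f) x) E /= hx linear0.
Qed.

Definition syzygy_map : {linear syzygy M -> syzygy M'} :=
  submod_map syzygy_map_subproof.

Fact Tor_map_subproof :
  {in ker_pred (tensor_map (syzygy_incl M) (lin_id N)), forall x,
    tensor_map syzygy_map g x
      \in ker_pred (tensor_map (syzygy_incl M') (lin_id N'))}.
Proof.
move=> x /eqP hx; apply/eqP.
rewrite (tensor_map_square (f2' := syzygy_incl M) (g2' := lin_id N)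
  (f1' := free_map R f) (g1' := g)) ?hx ?linear0 // => y.
Qed.

Definition Tor_map : {linear Tor M N -> Tor M' N'} :=
  submod_map Tor_map_subproof.
End Map.
End Tor.

Section DirectSum.
Variables (R : comNzRingType) (I : finType) (M : I -> lmodType R).

Definition dsum : Type := {dffun forall i, M i}.

HB.instance Definition _ := Choice.on dsum.

Implicit Types x y z : dsum.

Definition dsum_zero : dsum := [ffun i => 0 : M i].
Definition dsum_opp x : dsum := [ffun i => - x i].
Definition dsum_add x y : dsum := [ffun i => x i + y i].
Definition dsum_scale (a : R) x : dsum := [ffun i => a *: x i].

Fact dsum_addA : associative dsum_add.
Proof. by move=> x y z; apply/ffunP => i; rewrite !ffunE addrA. Qed.

Fact dsum_addC : commutative dsum_add.
Proof. by move=> x y; apply/ffunP => i; rewrite !ffunE addrC. Qed.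

Fact dsum_add0 : left_id dsum_zero dsum_add.
Proof. by move=> x; apply/ffunP => i; rewrite !ffunE add0r. Qed.

Fact dsum_addN : left_inverse dsum_zero dsum_opp dsum_add.
Proof. by move=> x; apply/ffunP => i; rewrite !ffunE addNr. Qed.

HB.instance Definition _ :=
  GRing.isZmodule.Build dsum dsum_addA dsum_addC dsum_add0 dsum_addN.

Fact dsum_scaleA a b x : dsum_scale a (dsum_scale b x) = dsum_scale (a * b) x.
Proof. by apply/ffunP => i; rewrite !ffunE scalerA. Qed.

Fact dsum_scale1 : left_id 1 dsum_scale.
Proof. by move=> x; apply/ffunP => i; rewrite !ffunE scale1r. Qed.

Fact dsum_scaleDr : right_distributive dsum_scale +%R.
Proof. by move=> a x y; apply/ffunP => i; rewrite !ffunE scalerDr. Qed.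

Fact dsum_scaleDl x : {morph dsum_scale^~ x : a b / a + b}.
Proof. by move=> a b; apply/ffunP => i; rewrite !ffunE scalerDl. Qed.

HB.instance Definition _ := GRing.Zmodule_isLmodule.Build R dsum
  dsum_scaleA dsum_scale1 dsum_scaleDr dsum_scaleDl.
End DirectSum.

Section DirectSumMap.
Variables (R : comNzRingType) (I : finType) (M N : I -> lmodType R).
Variable f : forall i, {linear M i -> N i}.

Definition dsum_map (x : dsum M) : dsum N := [ffun i => f i (x i)].

Fact dsum_map_is_linear : linear dsum_map.
Proof. by move=> a x y; apply/ffunP => i; rewrite !ffunE linearP. Qed.

HB.instance Definition _ := GRing.isLinear.Build R (dsum M) (dsum N) *:%R
  dsum_map dsum_map_is_linear.
End DirectSumMap.

Record chain_complex (R : comNzRingType) := ChainComplex {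
  chains : nat -> lmodType R;
  bd : forall n, {linear chains n.+1 -> chains n};
  bd_bd : forall n x, bd n (bd n.+1 x) = 0
}.

Record chain_map (R : comNzRingType) (C D : chain_complex R) := ChainMap {
  chain_map_fun : forall n, {linear chains C n -> chains D n};
  chain_map_bd : forall n x,
    chain_map_fun n (bd C n x) = bd D n (chain_map_fun n.+1 x)
}.

Section Homology.
Variables (R : comNzRingType).
Implicit Types C D : chain_complex R.

Definition cycle_pred C n : {pred chains C n} :=
  match n with
  | 0 => predT
  | m.+1 => ker_pred (bd C m)
  end.

Arguments cycle_pred : clear implicits.

Fact cycle_pred_closed C n : submod_closed (cycle_pred C n).
Proof. by case: n => [|n]; [split | apply: ker_pred_closed]. Qed.

HB.instance Definition _ C n :=
  GRing.isSubmodClosed.Build R (chains C n) (cycle_pred C n)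
    (cycle_pred_closed C n).

Definition boundary_pred C n : {pred submod (cycle_pred C n)} :=
  fun z => val z \in im_pred (bd C n).

Arguments boundary_pred : clear implicits.

Fact boundary_pred_closed C n : submod_closed (boundary_pred C n).
Proof.
have E z : (z \in boundary_pred C n) = (val z \in im_pred (bd C n)) by [].
split=> [|a x y]; rewrite !E ?raddf0 ?rpred0 // => hx hy.
by rewrite linearP rpredD ?rpredZ.
Qed.

HB.instance Definition _ C n :=
  GRing.isSubmodClosed.Build R (submod (cycle_pred C n)) (boundary_pred C n)
    (boundary_pred_closed C n).

Definition homology C n : lmodType R := quomod (boundary_pred C n).

Section Map.
Variables (C D : chain_complex R) (f : chain_map C D) (n : nat).

Fact cycle_map_subproof :
  {in cycle_pred C n, forall x, chain_map_fun f n x \in cycle_pred D n}.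
Proof.
case: n => [//|m] x /eqP hx; apply/eqP.
by rewrite -chain_map_bd hx linear0.
Qed.

Definition cycle_map :
    {linear submod (cycle_pred C n) -> submod (cycle_pred D n)} :=
  submod_map cycle_map_subproof.

Fact homology_map_subproof :
  {in boundary_pred C n, forall z, cycle_map z \in boundary_pred D n}.
Proof.
move=> z /asboolP[u hu]; apply/asboolP.
by exists (chain_map_fun f n.+1 u); rewrite -chain_map_bd hu.
Qed.

Definition homology_map : {linear homology C n -> homology D n} :=
  quo_map homology_map_subproof.
End Map.
End Homology.

(* Paths are indexed by their number n of vertices, i.e. n = p + 1 for
   p-paths; in particular [paths 0] is the degree -1 term, spanned by the
   empty path. *)
Section Paths.
Variables (R : comNzRingType).

Definition paths (V : finType) (n : nat) : lmodType R :=
  {ffun n.-tuple V -> R^o}.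

Section Basis.
Variables (V : finType) (n : nat).

Definition path_gen (t : n.-tuple V) : paths V n :=
  [ffun s : n.-tuple V => (s == t)%:R : R^o].

Lemma paths_sum (v : paths V n) : v = \sum_t (v t : R) *: path_gen t.
Proof.
apply/ffunP => s; rewrite sum_ffunE (bigD1 s) //= big1 ?addr0.
  by rewrite !ffunE eqxx /GRing.scale /= mulr1.
by move=> t ts; rewrite !ffunE eq_sym (negPf ts) scaler0.
Qed.

Section Lift.
Variables (M : lmodType R) (g : n.-tuple V -> M).

Definition path_lift_fun (v : paths V n) : M := \sum_t (v t : R) *: g t.

Fact path_lift_is_linear : linear path_lift_fun.
Proof.
move=> a x y; rewrite /path_lift_fun scaler_sumr -big_split /=.
by apply: eq_bigr => t _; rewrite !ffunE scalerDl scalerA.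
Qed.

HB.instance Definition _ := GRing.isLinear.Build R (paths V n) M *:%R
  path_lift_fun path_lift_is_linear.

Definition path_lift : {linear paths V n -> M} := path_lift_fun.

Lemma path_liftE t : path_lift (path_gen t) = g t.
Proof.
rewrite /path_lift /= /path_lift_fun (bigD1 t) //= big1 ?addr0.
  by rewrite ffunE eqxx scale1r.
by move=> s st; rewrite ffunE (negPf st) scale0r.
Qed.
End Lift.

Lemma paths_linE (M : lmodType R) (f : {linear paths V n -> M}) v :
  f v = \sum_t (v t : R) *: f (path_gen t).
Proof.
rewrite [v in LHS]paths_sum linear_sum; apply: eq_bigr => t _.
exact: linearZ_LR.
Qed.

Lemma paths_ext (M : lmodType R) (f g : {linear paths V n -> M}) :
  (forall t, f (path_gen t) = g (path_gen t)) -> f =1 g.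
Proof.
by move=> fg v; rewrite (paths_linE f) (paths_linE g); under eq_bigr do rewrite fg.
Qed.

(* The submodule generated by the elementary paths satisfying P. *)
Definition supported_pred (P : pred (n.-tuple V)) : {pred paths V n} :=
  fun v => [forall t, (v t != 0) ==> P t].

Lemma supportedP (P : pred (n.-tuple V)) (v : paths V n) :
  reflect (forall t, ~~ P t -> v t = 0) (v \in supported_pred P).
Proof.
apply: (iffP forallP) => h t.
  by move=> nPt; apply/eqP; apply: contraNT nPt => vt; apply: (implyP (h t)).
by apply/implyP; apply: contraR => /h ->.
Qed.

Fact supported_closed P : submod_closed (supported_pred P).
Proof.
split=> [|a x y /supportedP hx /supportedP hy]; apply/supportedP => t nPt.
  by rewrite ffunE.
by rewrite !ffunE hx ?hy // scaler0 addr0.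
Qed.

HB.instance Definition _ P :=
  GRing.isSubmodClosed.Build R (paths V n) (supported_pred P)
    (supported_closed P).

Lemma path_gen_supported (P : pred (n.-tuple V)) t :
  P t -> path_gen t \in supported_pred P.
Proof.
move=> Pt; apply/supportedP => s nPs; rewrite ffunE.
by case: eqP nPs => // ->; rewrite Pt.
Qed.

Definition regular (t : n.-tuple V) : bool := sorted (fun x y => x != y) t.

Definition regularize : {linear paths V n -> paths V n} :=
  path_lift (fun t => if regular t then path_gen t else 0).

Lemma regularizeE v t : regularize v t = if regular t then v t else 0.
Proof.
rewrite /regularize /= /path_lift_fun sum_ffunE (bigD1 t) //= big1 ?addr0.
  rewrite ffunE; case: ifP => _; rewrite !ffunE ?eqxx ?scaler0 //.
  by rewrite /GRing.scale /= mulr1.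
move=> s st; rewrite ffunE; case: ifP => _; rewrite !ffunE ?scaler0 //.
by rewrite eq_sym (negPf st) scaler0.
Qed.

Lemma regularize_gen t :
  regularize (path_gen t) = if regular t then path_gen t else 0.
Proof. exact: path_liftE. Qed.
End Basis.

Arguments regularize {V n}.

Definition face (V : finType) n (t : n.+1.-tuple V) (q : 'I_n.+1) : n.-tuple V :=
  [tuple tnth t (lift q i) | i < n].

Section Boundary.
Variables (V : finType) (w : V -> R).

Definition full_boundary n : {linear paths V n.+1 -> paths V n} :=
  path_lift (fun t =>
    \sum_(q < n.+1) ((-1) ^+ q * w (tnth t q)) *: path_gen (face t q)).

(* The boundary induced on regular paths via R_p = Lambda_p / I_p: the
   non-regular terms are set to 0. *)
Definition boundary n : {linear paths V n.+1 -> paths V n} :=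
  @regularize V n \o full_boundary n.

Lemma full_boundary_gen n (t : n.+1.-tuple V) :
  full_boundary n (path_gen t)
  = \sum_(q < n.+1) ((-1) ^+ q * w (tnth t q)) *: path_gen (face t q).
Proof. exact: path_liftE. Qed.

Definition path_cons n (x : V) : {linear paths V n -> paths V n.+1} :=
  path_lift (fun t => path_gen [tuple of x :: t]).

Lemma path_cons_gen n x (t : n.-tuple V) :
  path_cons n x (path_gen t) = path_gen [tuple of x :: t].
Proof. exact: path_liftE. Qed.

Lemma face0 n x (t : n.-tuple V) : face [tuple of x :: t] ord0 = t.
Proof. by apply: eq_from_tnth => i; rewrite tnth_mktuple tnthS. Qed.

Lemma faceS n x (t : n.+1.-tuple V) (q : 'I_n.+1) :
  face [tuple of x :: t] (lift ord0 q) = [tuple of x :: face t q].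
Proof.
apply: eq_from_tnth => i; rewrite tnth_mktuple.
case: (unliftP ord0 i) => [j|] ->.
  rewrite tnthS tnth_mktuple.
  have -> : lift (lift ord0 q) (lift ord0 j) = lift ord0 (lift q j).
    by apply: val_inj; rewrite /= /bump !leq0n /= !add1n ltnS addnS.
  by rewrite tnthS.
have -> : lift (lift ord0 q) ord0 = ord0 :> 'I_n.+2 by apply: val_inj.
by rewrite !tnth0.
Qed.

Lemma full_boundary_cons0 x (t : 0.-tuple V) :
  full_boundary 0 (path_gen [tuple of x :: t]) = w x *: path_gen t.
Proof.
by rewrite full_boundary_gen big_ord1 expr0 mul1r tnth0 face0.
Qed.

Lemma full_boundary_cons n x (v : paths V n.+1) :
  full_boundary n.+1 (path_cons n.+1 x v)
  = w x *: v - path_cons n x (full_boundary n v).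
Proof.
have -> : full_boundary n.+1 (path_cons n.+1 x v) =
    \sum_t (v t : R) *: full_boundary n.+1 (path_cons n.+1 x (path_gen t)).
  exact: paths_linE (full_boundary n.+1 \o path_cons n.+1 x) v.
have -> : path_cons n x (full_boundary n v) =
    \sum_t (v t : R) *: path_cons n x (full_boundary n (path_gen t)).
  exact: paths_linE (path_cons n x \o full_boundary n) v.
rewrite [v in _ *: v]paths_sum scaler_sumr -sumrB; apply: eq_bigr => t _.
rewrite scalerA mulrC -scalerA -scalerBr; congr (_ *: _).
rewrite path_cons_gen !full_boundary_gen big_ord_recl expr0 mul1r tnth0 face0.
congr (_ + _); rewrite (linear_sum (path_cons n x)) -sumrN; apply: eq_bigr => q _.
by rewrite linearZ_LR path_cons_gen faceS tnthS exprS mulN1r mulNr scaleNr.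
Qed.

Lemma full_boundaryK n v : full_boundary n (full_boundary n.+1 v) = 0.
Proof.
suff h t : full_boundary n (full_boundary n.+1 (path_gen t)) = 0.
  have -> : full_boundary n (full_boundary n.+1 v) =
      \sum_t (v t : R) *: full_boundary n (full_boundary n.+1 (path_gen t)).
    exact: paths_linE (full_boundary n \o full_boundary n.+1) v.
  by rewrite big1 // => t _; rewrite h scaler0.
elim: n t {v} => [|n IH] t; rewrite (tuple_eta t) -path_cons_gen.
  rewrite full_boundary_cons (tuple_eta (behead_tuple t)) full_boundary_cons0.
  rewrite (linearB (full_boundary 0)) (linearZ_LR (path_cons 0 _)).
  rewrite !(linearZ_LR (full_boundary 0)) path_cons_gen !full_boundary_cons0.
  by rewrite !scalerA mulrC subrr.
rewrite full_boundary_cons (linearB (full_boundary n.+1)).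
rewrite (linearZ_LR (full_boundary n.+1)) full_boundary_cons IH.
by rewrite (linear0 (path_cons n _)) subr0 subrr.
Qed.

Lemma regular_cons n x (t : n.-tuple V) :
  regular [tuple of x :: t] -> regular t.
Proof. by rewrite /regular /=; apply: path_sorted. Qed.

Lemma regularize_cons n x (v : paths V n) :
  regularize v = 0 -> regularize (path_cons n x v) = 0.
Proof.
move=> rv; have E : regularize (n := n.+1) \o path_cons n x
    =1 (regularize (n := n.+1) \o path_cons n x) \o regularize (n := n).
  apply: paths_ext => t /=; rewrite regularize_gen.
  case: ifP => [//|nt]; rewrite !linear0 path_cons_gen regularize_gen.
  by case: ifP => // /regular_cons; rewrite nt.
rewrite -[LHS]/((regularize (n := n.+1) \o path_cons n x) v) E.
by rewrite -[LHS]/(regularize (path_cons n x (regularize v))) rv !linear0.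
Qed.

Lemma boundary_nonregular n (t : n.+1.-tuple V) :
  ~~ regular t -> boundary n (path_gen t) = 0.
Proof.
rewrite /boundary /=; elim: n t => [|n IH] t.
  by have -> : regular t by case: t => -[|x [|y s]].
case/tupleP: t => x s nt.
rewrite -path_cons_gen full_boundary_cons (linearB regularize).
rewrite (linearZ_LR regularize).
have [rs|nrs] := boolP (regular s); last first.
  rewrite regularize_gen (negPf nrs) scaler0 sub0r regularize_cons ?oppr0 //.
  exact: IH.
case/tupleP: s nt rs => y u; rewrite /regular /= => nt rs.
have xy : x = y by apply/eqP; apply: contraNT nt => ->.
rewrite -{}xy in rs *; clear y IH nt; case: n u rs => [|n] u rs.
  rewrite full_boundary_cons0 regularize_gen /regular /= rs.
  rewrite (linearZ_LR (path_cons 0 _)) (linearZ_LR regularize) path_cons_gen.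
  by rewrite regularize_gen /regular /= rs subrr.
rewrite -(path_cons_gen x u) full_boundary_cons (linearB (path_cons n.+1 x)).
rewrite (linearB regularize) (linearZ_LR (path_cons n.+1 x)).
rewrite (linearZ_LR regularize) opprB addrCA subrr addr0.
set v := full_boundary _ _.
have -> : regularize (path_cons n.+1 x (path_cons n x v)) =
    \sum_r (v r : R) *:
      regularize (path_cons n.+1 x (path_cons n x (path_gen r))).
  exact: paths_linE ((regularize (n := n.+2) \o path_cons n.+1 x)
                       \o path_cons n x) v.
rewrite big1 // => r _.
by rewrite !path_cons_gen regularize_gen /regular /= eqxx scaler0.
Qed.

Lemma boundary_regularize n v : boundary n (regularize v) = boundary n v.
Proof.
have E : boundary n \o regularize (n := n.+1) =1 boundary n.
  apply: paths_ext => t; rewrite -[LHS]/(boundary n (regularize _)).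
  rewrite regularize_gen; case: ifP => // /negbT nt.
  by rewrite linear0 boundary_nonregular.
exact: E.
Qed.

Lemma boundaryK n v : boundary n (boundary n.+1 v) = 0.
Proof.
rewrite -[boundary n.+1 v]/(regularize (full_boundary n.+1 v)).
rewrite boundary_regularize -[LHS]/(regularize (full_boundary n _)).
by rewrite full_boundaryK linear0.
Qed.
End Boundary.

Section Push.
Variables (V V' : finType) (w : V -> R) (w' : V' -> R) (f : V -> V').

Definition full_push n : {linear paths V n -> paths V' n} :=
  path_lift (fun t => path_gen (map_tuple f t)).

Definition push n : {linear paths V n -> paths V' n} :=
  @regularize V' n \o full_push n.

Lemma full_push_gen n (t : n.-tuple V) :
  full_push n (path_gen t) = path_gen (map_tuple f t).
Proof. exact: path_liftE. Qed.

Lemma regular_map n (t : n.-tuple V) : regular (map_tuple f t) -> regular t.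
Proof.
rewrite /regular /= sorted_map; apply: sub_sorted => x y /=.
by apply: contra_neq => ->.
Qed.

Lemma push_regularize n v : push n (regularize v) = push n v.
Proof.
have E : push n \o regularize (n := n) =1 push n.
  apply: paths_ext => t; rewrite -[LHS]/(push n (regularize _)).
  rewrite regularize_gen; case: ifP => // nt; rewrite linear0.
  rewrite -[RHS]/(regularize (full_push n (path_gen t))).
  rewrite full_push_gen regularize_gen.
  by case: ifP => // /regular_map; rewrite nt.
exact: E.
Qed.

Hypothesis fw : forall x, w' (f x) = w x.

Lemma push_boundary n v : push n (boundary w n v) = boundary w' n (push n.+1 v).
Proof.
rewrite -[boundary w n v]/(regularize (full_boundary w n v)) push_regularize.
rewrite -[push n.+1 v]/(regularize (full_push n.+1 v)) boundary_regularize.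
rewrite -[LHS]/(regularize (full_push n _)).
rewrite -[RHS]/(regularize (full_boundary w' n _)); congr (regularize _).
have E : full_push n \o full_boundary w n =1 full_boundary w' n \o full_push n.+1.
  apply: paths_ext => t; rewrite -[LHS]/(full_push n (full_boundary w n _)).
  rewrite -[RHS]/(full_boundary w' n (full_push n.+1 _)).
  rewrite full_push_gen !full_boundary_gen (linear_sum (full_push n)); apply: eq_bigr => q _.
  rewrite linearZ_LR full_push_gen tnth_map fw; congr (_ *: path_gen _).
  by apply: eq_from_tnth => i; rewrite tnth_map !tnth_mktuple tnth_map.
exact: E.
Qed.
End Push.
End Paths.

Arguments regularize {R V n}.

Record wdigraph (R : comNzRingType) := WDigraph {
  vertex : finType;
  vertex_nonempty : (0 < #|vertex|)%N;
  edge : rel vertex;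
  edge_irreflexive : irreflexive edge;
  weight : vertex -> R
}.

Definition nonvanishing (R : comNzRingType) (G : wdigraph R) : Prop :=
  forall x : vertex G, weight x != 0.

Section PathComplex.
Variables (R : comNzRingType).
Implicit Types G : wdigraph R.

Definition allowed G n (t : n.-tuple (vertex G)) : bool := sorted (@edge R G) t.

Lemma allowed_regular G n (t : n.-tuple (vertex G)) : allowed t -> regular t.
Proof.
apply: sub_sorted => x y; apply: contraTneq => ->.
by rewrite edge_irreflexive.
Qed.

Definition allowed_pred G n : {pred paths R (vertex G) n} :=
  supported_pred (@allowed G n).

Arguments allowed_pred : clear implicits.

HB.instance Definition _ G n := GRing.SubmodClosed.on (allowed_pred G n).

Definition Omega_pred G n : {pred paths R (vertex G) n} :=
  match n with
  | 0 => allowed_pred G 0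
  | m.+1 => fun v =>
      (v \in allowed_pred G m.+1)
      && (boundary (@weight R G) m v \in allowed_pred G m)
  end.

Arguments Omega_pred : clear implicits.

Fact Omega_pred_closed G n : submod_closed (Omega_pred G n).
Proof.
case: n => [|n]; first exact: supported_closed.
split=> [|a x y /andP[x1 x2] /andP[y1 y2]]; apply/andP; split.
- exact: rpred0.
- by rewrite linear0; apply: rpred0.
- by apply: rpredD => //; apply: rpredZ.
- by rewrite (linearP (boundary _ n)); apply: rpredD => //; apply: rpredZ.
Qed.

HB.instance Definition _ G n :=
  GRing.isSubmodClosed.Build R (paths R (vertex G) n) (Omega_pred G n)
    (Omega_pred_closed G n).

Definition Omega G n : lmodType R := submod (Omega_pred G n).

Fact Omega_boundary_subproof G n :
  {in Omega_pred G n.+1, forall v, boundary (@weight R G) n v \in Omega_pred G n}.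
Proof.
case: n => [|n] v /andP[_ hv] //; apply/andP; split=> //.
by rewrite boundaryK; apply: rpred0.
Qed.

Definition Omega_boundary G n : {linear Omega G n.+1 -> Omega G n} :=
  submod_map (@Omega_boundary_subproof G n).

Fact Omega_boundaryK G n (v : Omega G n.+2) :
  Omega_boundary G n (Omega_boundary G n.+1 v) = 0.
Proof. by apply: val_inj; apply: boundaryK. Qed.

Definition path_complex G : chain_complex R := ChainComplex (@Omega_boundaryK G).

(* The homology of the augmented complex ... -> Omega_1 -> Omega_0 -> R -> 0, in
   degree p; it may be nonzero for p = -1, where it is R / (weights), and it is
   0 for p < -1. For p >= 1 it is the homology of the complex truncated at
   Omega_0. The truncated complex cannot be used in the Kunneth sequence: its
   homology is 0 in degree -1, so that for r = 0 both outer terms would vanish,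
   while the truncated H_0 of a join with nonvanishing weights is nonzero. *)
Definition path_homology G (p : int) : lmodType R :=
  match p with
  | Posz n => homology (path_complex G) n.+1
  | Negz 0 => homology (path_complex G) 0
  | Negz _.+1 => 'rV[R]_0
  end.

(* The morphisms for which naturality is stated: weight-preserving maps that
   send an edge to an edge or collapse it. *)
Record wdigraph_map G G' := WDigraphMap {
  vertex_map :> vertex G -> vertex G';
  vertex_map_edge : forall x y, edge x y ->
    edge (vertex_map x) (vertex_map y) || (vertex_map x == vertex_map y);
  vertex_map_weight : forall x, weight (vertex_map x) = weight x
}.

Section Induced.
Variables (G G' : wdigraph R) (f : wdigraph_map G G').

Lemma push_allowed n v :
  v \in allowed_pred G n -> push R f n v \in allowed_pred G' n.
Proof.
move=> /supportedP hv; apply/supportedP => s ns.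
rewrite -[push R f n v]/(regularize (full_push R f n v)) regularizeE.
case: ifP => // rs; rewrite (paths_linE (full_push R f n)) sum_ffunE.
apply: big1 => t _; rewrite ffunE full_push_gen ffunE.
case: eqP => [est|_]; last by rewrite scaler0.
have [at_|/hv ->] := boolP (allowed t); last by rewrite scale0r.
case/negP: ns; rewrite /allowed est /=; move: rs; rewrite /regular est /=.
rewrite !sorted_map; move: at_; rewrite /allowed.
case: (tval t) => //= x u; elim: u x => //= y u IH x /andP[xy yu] /andP[nxy nu].
rewrite IH // andbT.
by have := vertex_map_edge f xy; rewrite (negPf nxy) orbF.
Qed.

Fact Omega_map_subproof n :
  {in Omega_pred G n, forall v, push R f n v \in Omega_pred G' n}.
Proof.
case: n => [|n] v; first exact: push_allowed.
case/andP=> hv bv; apply/andP; split; first exact: push_allowed.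
by rewrite -(push_boundary (vertex_map_weight f)) push_allowed.
Qed.

Definition Omega_map n : {linear Omega G n -> Omega G' n} :=
  submod_map (@Omega_map_subproof n).

Fact Omega_map_bd n (v : Omega G n.+1) :
  Omega_map n (Omega_boundary G n v) = Omega_boundary G' n (Omega_map n.+1 v).
Proof. by apply: val_inj; apply: (push_boundary (vertex_map_weight f)). Qed.

Definition path_complex_map : chain_map (path_complex G) (path_complex G') :=
  @ChainMap R (path_complex G) (path_complex G') Omega_map Omega_map_bd.

Definition path_homology_map (p : int) :
    {linear path_homology G p -> path_homology G' p} :=
  match p with
  | Posz n => homology_map path_complex_map n.+1
  | Negz 0 => homology_map path_complex_map 0
  | Negz _.+1 => lin_id _
  end.
End Induced.
End PathComplex.

Section Join.
Variable R : comNzRingType.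

Section JoinDef.
Variables G G' : wdigraph R.

Definition join_edge : rel (vertex G + vertex G')%type := fun u v =>
  match u, v with
  | inl x, inl y => edge x y
  | inr x, inr y => edge x y
  | inl _, inr _ => true
  | inr _, inl _ => false
  end.

Fact join_edge_irreflexive : irreflexive join_edge.
Proof. by case=> x; apply: edge_irreflexive. Qed.

Definition join_weight (u : vertex G + vertex G') : R :=
  match u with
  | inl x => weight x
  | inr x => weight x
  end.

Fact join_nonempty : (0 < #|{: vertex G + vertex G'}|)%N.
Proof. by rewrite card_sum addn_gt0 vertex_nonempty. Qed.

Definition join : wdigraph R :=
  WDigraph join_nonempty join_edge_irreflexive join_weight.
End JoinDef.

Section JoinMap.
Variables (G1 G2 G1' G2' : wdigraph R).
Variables (f : wdigraph_map G1 G2) (f' : wdigraph_map G1' G2').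

Definition join_vertex_map (u : vertex (join G1 G1')) : vertex (join G2 G2') :=
  match u with
  | inl x => inl (f x)
  | inr x => inr (f' x)
  end.

Fact join_vertex_map_edge x y : edge x y ->
  edge (join_vertex_map x) (join_vertex_map y)
  || (join_vertex_map x == join_vertex_map y).
Proof.
case: x y => x [] y //= xy; first exact: (vertex_map_edge f xy).
exact: (vertex_map_edge f' xy).
Qed.

Fact join_vertex_map_weight x : weight (join_vertex_map x) = weight x.
Proof.
case: x => x; [exact: (vertex_map_weight f) | exact: (vertex_map_weight f')].
Qed.

Definition join_map : wdigraph_map (join G1 G1') (join G2 G2') :=
  WDigraphMap join_vertex_map_edge join_vertex_map_weight.
End JoinMap.
End Join.

Section Kunneth.
Variables (R : comNzRingType) (r : nat).
Implicit Types G : wdigraph R.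

Local Notation deg1 i := ((i : nat)%:Z - 1).
Local Notation deg2 i := (r%:Z - (i : nat)%:Z).

(* For i < r + 2, the pairs (deg1 i, deg2 i) = (i - 1, r - i) are exactly the
   pairs (p, q) with p, q >= -1 and p + q = r - 1. *)
Definition tensor_sum G G' : lmodType R := dsum (fun i : 'I_r.+2 =>
  tensor (path_homology G (deg1 i)) (path_homology G' (deg2 i))).

Definition tor_sum G G' : lmodType R := dsum (fun i : 'I_r.+2 =>
  Tor (path_homology G (deg1 i)) (path_homology G' (deg2 i - 1))).

Section Map.
Variables (G1 G2 G1' G2' : wdigraph R).
Variables (f : wdigraph_map G1 G2) (f' : wdigraph_map G1' G2').

Definition tensor_sum_map : {linear tensor_sum G1 G1' -> tensor_sum G2 G2'} :=
  dsum_map (fun i : 'I_r.+2 =>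
    tensor_map (path_homology_map f (deg1 i)) (path_homology_map f' (deg2 i))).

Definition tor_sum_map : {linear tor_sum G1 G1' -> tor_sum G2 G2'} :=
  dsum_map (fun i : 'I_r.+2 =>
    Tor_map (path_homology_map f (deg1 i)) (path_homology_map f' (deg2 i - 1))).
End Map.
End Kunneth.

Definition short_exact (R : comNzRingType) (A B C : lmodType R)
    (a : {linear A -> B}) (b : {linear B -> C}) : Prop :=
  [/\ injective a,
      forall y, b y = 0 <-> exists x, a x = y
    & forall z, exists y, b y = z].

Definition splits (R : comNzRingType) (B C : lmodType R)
    (b : {linear B -> C}) : Prop :=
  exists s : {linear C -> B}, forall z, b (s z) = z.

Definition principal_ideal_domain (R : idomainType) : Prop :=
  forall I : R -> Prop,
    I 0 -> (forall x y, I x -> I y -> I (x + y)) ->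
    (forall a x, I x -> I (a * x)) ->
  exists g, forall x, I x <-> exists a, x = a * g.

(* Main.v *)
(* Write degrees as numbers of vertices. Concatenation of paths identifies the
   complex Omega(G * G') with the total complex of Omega(G) (x) Omega(G'): the
   allowed paths of G * G' are the concatenations of allowed paths of G and of G',
   and since Omega is the kernel of a map between finite free modules, flatness
   shows that an element of Omega(G * G') has its components in
   Omega_i(G) (x) Omega_j(G').

   It remains to prove the Kunneth theorem for free complexes C and D over a PID,
   with explicit maps. Choose retractions C_n -> Z_n, giving maps rho : C_n -> H_n
   that vanish on boundaries, and lifts Z_n -> F(H_n), which composed with the
   differential give theta : C_(n+1) -> syzygy(H_n). The cross product alpha has the
   left inverse induced by rho (x) rho, and beta is induced by theta (x) rho; beta
   does not depend on the choices, hence it is natural. The decomposition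
   C_n = Z_n (+) B_(n-1) shows that ker beta = im alpha and that beta is onto; the
   left inverse of alpha then yields the splitting. *)
From HB Require Import structures.
Require Import Defs.
From mathcomp Require Import multinomials.freeg.
From mathcomp Require Import all_boot all_order all_algebra.
From mathcomp Require Import boolp.

Set Implicit Arguments.
Unset Strict Implicit.
Unset Printing Implicit Defensive.

Import Order.TTheory GRing.Theory Num.Theory.

Local Open Scope ring_scope.

(** * Tensor products and flatness *)

(** Naturality is asked of maps given for all digraphs at once, while the splittings are chosen
    digraph by digraph and commute with no chain map. So alpha depends on concatenation alone, and
    the choices inside beta are shown to be harmless: another lift into the free cover changes
    [theta] by a map through the differential, another retraction changes [rho] by a map that kills
    cycles, and on cycles of the total complex both changes contribute nothing. [Tor] is computed
    from the free module on all elements of the homology, in general of infinite rank. Finiteness is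
    used only for chains, cycles and boundaries, where a dual basis ([fproj]) takes the place of
    freeness and gives lifting and flatness. Allowed paths do not span Omega, since a boundary may
    become allowed by cancellation only. Hence nothing about Omega of a join can be checked on paths
    alone, and membership in Omega is handled as a system of linear equations. *)

Section Tensors.
Variable R : comNzRingType.
Implicit Types M N P Q : lmodType R.

Definition linmap M N (f : M -> N) (fl : linear f) : {linear M -> N} :=
  HB.pack f (GRing.isLinear.Build R M N *:%R f fl).

Lemma linmapP M N (f : M -> N) : linear f ->
  exists F : {linear M -> N}, forall x, F x = f x.
Proof. by move=> fl; exists (linmap fl). Qed.

Section Corestrict.
Variables (M N : lmodType R) (S : submodClosed N) (f : {linear M -> N}).
Hypothesis fS : forall x, f x \in S.

Fact corestrict_linear : linear (fun x => Submod (fS x)).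
Proof. by move=> a x y; apply: val_inj; rewrite /= (linearP f). Qed.

Definition corestrict : {linear M -> submod S} := linmap corestrict_linear.
End Corestrict.

Arguments quo_lift : simpl never.
Arguments tens : simpl never.

Section Bilinear.
Variables M N : lmodType R.

Let bilin_eq u v : bilinear_rel (u - v) ->
  quo (span_pred (@bilinear_rel R M N)) u = quo _ v.
Proof. by move=> h; apply/quo_eqP/span_gen. Qed.

Lemma tensDl x x' y : tens (x + x' : M) (y : N) = tens x y + tens x' y.
Proof. by rewrite -quoD; apply: bilin_eq; apply: BilinDl. Qed.

Lemma tensDr x y y' : tens (x : M) (y + y' : N) = tens x y + tens x y'.
Proof. by rewrite -quoD; apply: bilin_eq; apply: BilinDr. Qed.

Lemma tensZl a x y : tens (a *: x : M) (y : N) = a *: tens x y.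
Proof.
by rewrite /tens -(linearZ_LR (quo _)); apply: bilin_eq; apply: BilinZl.
Qed.

Lemma tensZr a x y : tens (x : M) (a *: y : N) = a *: tens x y.
Proof.
by rewrite /tens -(linearZ_LR (quo _)); apply: bilin_eq; apply: BilinZr.
Qed.

Lemma tens_linear_l y : linear (fun x : M => tens x (y : N)).
Proof. by move=> a x x'; rewrite tensDl tensZl. Qed.

Lemma tens_linear_r x : linear (fun y : N => tens (x : M) y).
Proof. by move=> a y y'; rewrite tensDr tensZr. Qed.

Definition tens_r (x : M) : {linear N -> tensor M N} :=
  linmap (tens_linear_r x).

Definition tens_l (y : N) : {linear M -> tensor M N} :=
  linmap (tens_linear_l y).

Lemma tens0l (y : N) : tens (0 : M) y = 0.
Proof. exact: (linear0 (tens_l y)). Qed.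

Lemma tens0r (x : M) : tens x (0 : N) = 0.
Proof. exact: (linear0 (tens_r x)). Qed.

Lemma tensBl (x x' : M) (y : N) : tens (x - x') y = tens x y - tens x' y.
Proof. exact: (linearB (tens_l y)). Qed.

Lemma tensBr (x : M) (y y' : N) : tens x (y - y') = tens x y - tens x y'.
Proof. exact: (linearB (tens_r x)). Qed.

Section Lift.
Variables (P : lmodType R) (f : M -> N -> P).
Hypotheses (fl : forall y, linear (f^~ y)) (fr : forall x, linear (f x)).

Let flift : {linear {freeg (M * N)%type / R} -> P} :=
  free_lift (fun p => f p.1 p.2).

Fact tensor_lift_subproof :
  {in span_pred (@bilinear_rel R M N), forall x, flift x = 0}.
Proof.
move=> x hx; have : x \in ker_pred flift.
  have gE u v : flift (free_gen R (u, v)) = f u v by exact: free_liftE.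
  have hD u v : flift (u + v) = flift u + flift v by exact: linearD.
  have hB u v : flift (u - v) = flift u - flift v by exact: linearB.
  have hZ a u : flift (a *: u) = a *: flift u by exact: linearZ_LR.
  have f0l v : f 0 v = 0.
    by have := fl v (-1) 0 0; rewrite scaler0 addr0 scaleN1r addNr.
  have f0r u : f u 0 = 0.
    by have := fr u (-1) 0 0; rewrite scaler0 addr0 scaleN1r addNr.
  apply: (span_sub _ hx) => y; case=> [u u' v|u v v'|a u v|a u v]; apply/eqP.
  - by rewrite hB hD !gE -[u]scale1r fl !scale1r subrr.
  - by rewrite hB hD !gE -[v]scale1r fr !scale1r subrr.
  - by rewrite hB hZ !gE -[a *: u]addr0 fl f0l addr0 subrr.
  - by rewrite hB hZ !gE -[a *: v]addr0 fr f0r addr0 subrr.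
by move/eqP.
Qed.

Definition tensor_lift : {linear tensor M N -> P} :=
  quo_lift tensor_lift_subproof.

Arguments tensor_lift : simpl never.

Lemma tensor_liftE x y : tensor_lift (tens x y) = f x y.
Proof. exact: etrans (quo_liftE _ _) (free_liftE _ _). Qed.
End Lift.
End Bilinear.

Lemma tensor_map_comp M N M1 N1 M2 N2 (f : {linear M1 -> M2})
    (g : {linear N1 -> N2}) (f' : {linear M -> M1}) (g' : {linear N -> N1}) z :
  tensor_map f g (tensor_map f' g' z) = tensor_map (f \o f') (g \o g') z.
Proof.
have E : tensor_map f g \o tensor_map f' g' =1 tensor_map (f \o f') (g \o g').
  apply: tensor_ext => x y.
  rewrite -[LHS]/(tensor_map f g (tensor_map f' g' (tens x y))).
  by rewrite !tensor_mapE.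
exact: E.
Qed.

Lemma eq_tensor_map M N M1 N1 (f f' : {linear M -> M1}) (g g' : {linear N -> N1}) :
  f =1 f' -> g =1 g' -> tensor_map f g =1 tensor_map f' g'.
Proof. by move=> ff gg; apply: tensor_ext => x y; rewrite !tensor_mapE ff gg. Qed.

Lemma tensor_map_id M N (f : {linear M -> M}) (g : {linear N -> N}) z :
  f =1 id -> g =1 id -> tensor_map f g z = z.
Proof.
move=> ff gg; have E : tensor_map f g =1 lin_id (tensor M N).
  by apply: tensor_ext => x y; rewrite tensor_mapE ff gg.
exact: E.
Qed.

Lemma tensor_map0l M N M1 N1 (f : {linear M -> M1}) (g : {linear N -> N1}) z :
  (forall x, f x = 0) -> tensor_map f g z = 0.
Proof.
move=> f0; have E : tensor_map f g =1 (\0 : {linear _ -> tensor M1 N1}).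
  by apply: tensor_ext => x y; rewrite tensor_mapE f0 tens0l.
exact: E.
Qed.

Lemma tensor_map0r M N M1 N1 (f : {linear M -> M1}) (g : {linear N -> N1}) z :
  (forall x, g x = 0) -> tensor_map f g z = 0.
Proof.
move=> g0; have E : tensor_map f g =1 (\0 : {linear _ -> tensor M1 N1}).
  by apply: tensor_ext => x y; rewrite tensor_mapE g0 tens0r.
exact: E.
Qed.

Lemma tensor_mapDl M N M1 N1 (f f1 f2 : {linear M -> M1})
    (g : {linear N -> N1}) z : (forall x, f x = f1 x + f2 x) ->
  tensor_map f g z = tensor_map f1 g z + tensor_map f2 g z.
Proof.
move=> h; have E : tensor_map f g =1 tensor_map f1 g \+ tensor_map f2 g.
  apply: tensor_ext => x y.
  rewrite -[RHS]/(tensor_map f1 g (tens x y) + tensor_map f2 g (tens x y)).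
  by rewrite !tensor_mapE h tensDl.
exact: E.
Qed.

Lemma tensor_mapDr M N M1 N1 (f : {linear M -> M1})
    (g g1 g2 : {linear N -> N1}) z : (forall x, g x = g1 x + g2 x) ->
  tensor_map f g z = tensor_map f g1 z + tensor_map f g2 z.
Proof.
move=> h; have E : tensor_map f g =1 tensor_map f g1 \+ tensor_map f g2.
  apply: tensor_ext => x y.
  rewrite -[RHS]/(tensor_map f g1 (tens x y) + tensor_map f g2 (tens x y)).
  by rewrite !tensor_mapE h tensDr.
exact: E.
Qed.

Definition tensor_swap M N : {linear tensor M N -> tensor N M} :=
  tensor_lift (f := fun x y => tens y x) (fun y => tens_linear_r y)
    (fun x => @tens_linear_l N M x).

Arguments tensor_swap : simpl never.

Lemma tensor_swapE M N (x : M) (y : N) : tensor_swap M N (tens x y) = tens y x.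
Proof. exact: tensor_liftE. Qed.

Lemma tensor_swapK M N : cancel (tensor_swap M N) (tensor_swap N M).
Proof.
have E : tensor_swap N M \o tensor_swap M N =1 lin_id _.
  by apply: tensor_ext => x y; rewrite /= !tensor_swapE.
exact: E.
Qed.

Lemma tensor_swap_map M N M1 N1 (f : {linear M -> M1}) (g : {linear N -> N1}) z :
  tensor_swap _ _ (tensor_map f g z) = tensor_map g f (tensor_swap _ _ z).
Proof.
have E : tensor_swap _ _ \o tensor_map f g
         =1 tensor_map g f \o tensor_swap _ _.
  apply: tensor_ext => x y; rewrite -[LHS]/(tensor_swap _ _ (tensor_map f g _)).
  rewrite -[RHS]/(tensor_map g f (tensor_swap _ _ (tens x y))).
  by rewrite tensor_mapE !tensor_swapE tensor_mapE.
exact: E.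
Qed.

(** Composed with the quotient by [S], membership becomes the vanishing of a linear map, which pure
    tensors detect. *)
Lemma tensor_range M N P (S : submodClosed P) (f : {linear tensor M N -> P}) z :
  (forall x y, f (tens x y) \in S) -> f z \in S.
Proof.
move=> fS; apply/quo_eq0.
have E : quo S \o f =1 (\0 : {linear _ -> quomod S}).
  by apply: tensor_ext => x y; apply/quo_eq0.
exact: E.
Qed.

Section Contract.
Variables (M N : lmodType R) (c : {linear M -> R^o}).

Fact contract_linear_l (y : N) : linear (fun x => (c x : R) *: y).
Proof. by move=> a x x'; rewrite linearP scalerDl scalerA. Qed.

Fact contract_linear_r x : linear (fun y : N => (c x : R) *: y).
Proof. by move=> a y y'; rewrite scalerDr !scalerA mulrC. Qed.

(** The coordinate [c] tensored with [N], read through the identification of R (x) N with [N]. *)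
Definition contract : {linear tensor M N -> N} :=
  tensor_lift contract_linear_l contract_linear_r.

Arguments contract : simpl never.

Lemma contractE x y : contract (tens x y) = (c x : R) *: y.
Proof. exact: tensor_liftE. Qed.
End Contract.

Lemma contract_map M N N1 (c : {linear M -> R^o}) (g : {linear N -> N1}) z :
  contract N1 c (tensor_map (lin_id M) g z) = g (contract N c z).
Proof.
have E : contract N1 c \o tensor_map (lin_id M) g =1 g \o contract N c.
  apply: tensor_ext => x y.
  rewrite -[LHS]/(contract N1 c (tensor_map (lin_id M) g (tens x y))).
  by rewrite tensor_mapE /= !contractE linearZ_LR.
exact: E.
Qed.

(* Dual basis form of "finitely generated projective". *)
Definition fproj M : Prop := exists (k : nat) (e : 'I_k -> M)
  (c : 'I_k -> {linear M -> R^o}), forall x, x = \sum_i (c i x : R) *: e i.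

Lemma fproj_lift M N P (g : {linear N -> P}) (f : {linear M -> P}) :
  fproj M -> (forall x, exists y, g y = f x) ->
  exists h : {linear M -> N}, forall x, g (h x) = f x.
Proof.
move=> [k [e [c ec]]] gs.
have [y yE] := fin_all_exists (fun i => gs (e i)).
pose h x := \sum_i (c i x : R) *: y i.
have hl : linear h.
  move=> a u v; rewrite /h scaler_sumr -big_split /=; apply: eq_bigr => i _.
  by rewrite linearP scalerDl scalerA.
pose H := linmap hl.
exists H => x; rewrite [in RHS](ec x) !linear_sum; apply: eq_bigr => i _.
by rewrite !linearZ_LR yE.
Qed.

(** The dual basis gives each tensor finitely many coordinates in [N]; all flatness statements below
    reduce to these coordinates. *)
Lemma fproj_tensorE M N (k : nat) (e : 'I_k -> M) (c : 'I_k -> {linear M -> R^o}) :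
  (forall x, x = \sum_i (c i x : R) *: e i) ->
  forall z : tensor M N, z = \sum_i tens (e i) (contract N (c i) z).
Proof.
move=> ec z; pose h z : tensor M N := \sum_i tens (e i) (contract N (c i) z).
have hl : linear h.
  move=> a u v; rewrite /h scaler_sumr -big_split /=; apply: eq_bigr => i _.
  by rewrite linearP tensDr tensZr.
pose H := linmap hl.
have E : lin_id _ =1 H.
  apply: tensor_ext => x y; rewrite /= /h [in LHS](ec x).
  rewrite -[LHS]/(tens_l M y _) linear_sum; apply: eq_bigr => i _.
  by rewrite contractE tensZr -tensZl.
exact: E.
Qed.

Section FprojTensor.
Variables (M : lmodType R) (Mp : fproj M).

(** Flatness as an inclusion of kernels, which avoids tensoring a kernel with [M]. There are two
    maps [f1] and [f2] because Omega is defined by two conditions, one on a chain and one on its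
    boundary. *)
Lemma fproj_flat2 N N1 N2 N3 (f1 : {linear N -> N1}) (f2 : {linear N -> N2})
    (g : {linear N -> N3}) z :
  (forall x, f1 x = 0 -> f2 x = 0 -> g x = 0) ->
  tensor_map (lin_id M) f1 z = 0 -> tensor_map (lin_id M) f2 z = 0 ->
  tensor_map (lin_id M) g z = 0.
Proof.
move: Mp => [k [e [c ec]]] fg z1 z2.
rewrite (fproj_tensorE ec z) linear_sum big1 // => i _.
by rewrite tensor_mapE fg ?tens0r // -contract_map ?z1 ?z2 linear0.
Qed.

Lemma fproj_flat N N1 N2 (f : {linear N -> N1}) (g : {linear N -> N2}) z :
  (forall x, f x = 0 -> g x = 0) ->
  tensor_map (lin_id M) f z = 0 -> tensor_map (lin_id M) g z = 0.
Proof. by move=> fg fz; apply: (fproj_flat2 (f1 := f) (f2 := f)) => // x /fg. Qed.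

Lemma fproj_exact N N1 N2 (f : {linear N1 -> N}) (g : {linear N -> N2}) z :
  (forall x, g x = 0 -> exists y, f y = x) -> tensor_map (lin_id M) g z = 0 ->
  exists w, tensor_map (lin_id M) f w = z.
Proof.
move: Mp => [k [e [c ec]]] fg gz.
have h i : exists y, f y = contract N (c i) z.
  by apply: fg; rewrite -contract_map gz linear0.
have [y yE] := fin_all_exists h; exists (\sum_i tens (e i) (y i)).
rewrite linear_sum [RHS](fproj_tensorE ec z); apply: eq_bigr => i _.
by rewrite tensor_mapE yE.
Qed.

Lemma fproj_surj N N1 (f : {linear N1 -> N}) (z : tensor M N) :
  (forall x, exists y, f y = x) -> exists w, tensor_map (lin_id M) f w = z.
Proof.
move=> fs; apply: (@fproj_exact N N1 N f (\0 : {linear N -> N})) => [x _|].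
  exact: fs.
exact: tensor_map0r.
Qed.

Lemma fproj_flat2_l N N1 N2 N3 (f1 : {linear N -> N1}) (f2 : {linear N -> N2})
    (g : {linear N -> N3}) z :
  (forall x, f1 x = 0 -> f2 x = 0 -> g x = 0) ->
  tensor_map f1 (lin_id M) z = 0 -> tensor_map f2 (lin_id M) z = 0 ->
  tensor_map g (lin_id M) z = 0.
Proof.
move=> fg z1 z2; apply: (can_inj (@tensor_swapK _ _)).
rewrite tensor_swap_map linear0; apply: (fproj_flat2 fg).
  by rewrite -tensor_swap_map z1 linear0.
by rewrite -tensor_swap_map z2 linear0.
Qed.

Lemma fproj_flat_l N N1 N2 (f : {linear N -> N1}) (g : {linear N -> N2}) z :
  (forall x, f x = 0 -> g x = 0) ->
  tensor_map f (lin_id M) z = 0 -> tensor_map g (lin_id M) z = 0.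
Proof. by move=> fg fz; apply: (fproj_flat2_l (f1 := f) (f2 := f)) => // x /fg. Qed.
End FprojTensor.

(* Equivalently, M embeds in some R^k. *)
Definition separated M : Prop := exists (k : nat) (f : 'I_k -> {linear M -> R^o}),
  forall x, (forall i, f i x = 0) -> x = 0.

Lemma separated_inj M N (j : {linear M -> N}) :
  (forall x, j x = 0 -> x = 0) -> separated N -> separated M.
Proof.
move=> j0 [k [f f0]]; exists k, (fun i => f i \o j) => x fx.
exact/j0/f0.
Qed.

Lemma separated_prod M N : separated M -> separated N -> separated (M * N)%type.
Proof.
move=> [k [f f0]] [l [g g0]]; exists (k + l)%N.
exists (fun i => match split i return {linear (M * N)%type -> R^o} with
  | inl j => f j \o fst
  | inr j => g j \o snd
  end) => -[x y] h; congr (_, _).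
  apply: f0 => j; have := h (unsplit (inl j)); by rewrite unsplitK.
by apply: g0 => j; have := h (unsplit (inr j)); rewrite unsplitK.
Qed.

Lemma separated_ffun (I : finType) (M : lmodType R)
    (ev : I -> {linear M -> R^o}) :
  (forall x, (forall i, ev i x = 0) -> x = 0) -> separated M.
Proof.
move=> h; exists #|I|, (fun i => ev (enum_val i)) => x hx.
by apply: h => i; rewrite -(enum_rankK i).
Qed.
End Tensors.
Arguments contract {R M} N c.

(** * Projectivity over a principal ideal domain *)

Section PID.
Variables (R : idomainType) (R_pid : principal_ideal_domain R).
Implicit Types M N : lmodType R.

(* Submodules of R^k are projective: the image of the first coordinate is
   an ideal (g), and M splits off a copy of it. *)
Lemma separated_fproj M : separated M -> fproj M.
Proof.
move=> [k [f f0]]; elim: k => [|k IH] in M f f0 *.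
  exists 0%N, (fun _ => 0), (fun _ => \0) => x.
  by rewrite big_ord0; apply: f0 => -[].
pose f' := f ord0.
have [|u v [x <-] [y <-]|a u [x <-]|g gE] := R_pid (I := fun u => exists x, f' x = u).
- by exists 0; rewrite linear0.
- by exists (x + y); rewrite linearD.
- by exists (a *: x); rewrite linearZ_LR.
have [g0|gn0] := eqVneq g 0.
  apply: (IH M (fun i => f (lift ord0 i))) => x hx; apply: f0 => i.
  case: (unliftP ord0 i) => [j|] -> //.
  by have [|a ->] := (gE (f' x)).1; [exists x | rewrite g0 mulr0].
have [m0 m0E] : exists x, f' x = g by apply/gE; exists 1; rewrite mul1r.
(* [c] is [f'] divided by [g]: cancelling [g] makes it linear, and [c m0 = 1] splits M as R m0 (+)
   ker C, where the kernel is separated by the other [k] coordinates. *)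
have /choice[c cE] : forall x, exists a : R, f' x = a * g.
  by move=> x; apply/gE; exists x.
have cl : linear (c : M -> R^o).
  move=> a x y; apply: (mulIf gn0).
  by rewrite -cE linearP !cE mulrDl [_ *: _]mulrA.
have [C CE] := linmapP cl.
have Cm0 : c m0 = 1 by apply: (mulIf gn0); rewrite -cE m0E mul1r.
pose K : lmodType R := submod (ker_pred C).
have [|l [e [d de]]] := IH K (fun i => f (lift ord0 i) \o submod_incl _).
  move=> x hx; apply: val_inj; apply: f0 => i.
  case: (unliftP ord0 i) => [j|] ->; first exact: hx.
  rewrite -[LHS]/(f' (val x)) cE; have /eqP := valP x.
  by rewrite CE => ->; rewrite mul0r.
have pK x : x - (C x : R) *: m0 \in ker_pred C.
  by apply/eqP; rewrite linearB linearZ_LR (CE m0) Cm0 [_ *: _]mulr1 subrr.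
pose p x : K := Submod (pK x).
have pl : linear p.
  move=> a x y; apply: val_inj; rewrite /= (linearP C).
  by rewrite scalerDl scalerBr scalerA opprD addrACA.
have [P PE] := linmapP pl.
exists l.+1, (fun i => if unlift ord0 i is Some j then val (e j) else m0).
exists (fun i => match unlift ord0 i return {linear M -> R^o} with
  | Some j => d j \o P
  | None => C
  end) => x.
rewrite big_ord_recl unlift_none; under eq_bigr => i _ do rewrite liftK.
have -> : \sum_i (d i (P x) : R) *: val (e i) = val (P x).
  by rewrite [in RHS](de (P x)) (linear_sum (submod_incl _)).
by rewrite PE /= addrC subrK.
Qed.

Lemma fproj_inj M N (j : {linear M -> N}) :
  (forall x, j x = 0 -> x = 0) -> separated N -> fproj M.
Proof. by move=> j0 /(separated_inj j0)/separated_fproj. Qed.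

(** The image of [f] lies in a separated module, hence is projective; a section [s] over it gives
    the projection x - s (f x) onto the kernel. [S] is any predicate that agrees with the kernel,
    because Omega is not literally defined as one. *)
Lemma ker_retraction M N (f : {linear M -> N}) (S : submodClosed M) :
  separated N -> (forall x, (x \in S) = (f x == 0)) ->
  exists p : {linear M -> submod S}, forall x, p (val x) = x.
Proof.
move=> Ns SE; pose B : lmodType R := submod (im_pred f).
have fB x : f x \in im_pred f by apply/asboolP; exists x.
pose f' x : B := Submod (fB x).
have fl : linear f' by move=> a x y; apply: val_inj; rewrite /= (linearP f).
have [F FE] := linmapP fl.
have Bp : fproj B.
  by apply: (fproj_inj (j := submod_incl _)) Ns => x hx; apply: val_inj.
have [s sE] : exists s : {linear B -> M}, forall b, F (s b) = b.
  have := fproj_lift (g := F) (f := lin_id B) Bp; apply => b.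
  by case: b => b hb; have /asboolP[x xb] := hb; exists x; rewrite FE; apply: val_inj.
have pS x : x - s (F x) \in S.
  by rewrite SE linearB -[f (s _)]/(val (f' (s _))) -FE sE FE subrr.
pose p x : submod S := Submod (pS x).
have pl : linear p.
  move=> a x y; apply: val_inj; rewrite /= (linearP F) (linearP s).
  by rewrite scalerDr scalerN opprD addrACA.
exists (linmap pl) => x.
apply: val_inj; rewrite /=; have -> : F (val x) = 0.
  by rewrite FE; apply: val_inj; apply/eqP; rewrite /= -SE; apply: valP.
by rewrite linear0 subr0.
Qed.
End PID.

Arguments cycle_pred {R} C n.
Arguments boundary_pred {R} C n.

(** * Chain complexes *)

Section Bigraded.
Variables (R : comNzRingType) (T : nat -> nat -> lmodType R) (E : nat -> lmodType R).
Variables (d1 : forall a b, {linear T a b -> T a.-1 b})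
  (d2 : forall a b, {linear T a b -> T a b.-1})
  (m : forall a b n, {linear T a b -> E n})
  (p : forall a b n, {linear E n -> T a b})
  (d : forall n, {linear E n.+1 -> E n}).
Hypotheses (d1_0 : forall b z, d1 0 b z = 0) (d2_0 : forall a z, d2 a 0 z = 0)
  (mK : forall a b n z, (a + b)%N = n -> p a b n (m a b n z) = z)
  (m_orth : forall a b a' b' n z, a <> a' -> p a b n (m a' b' n z) = 0)
  (p_out : forall a b n x, (a + b)%N <> n -> p a b n x = 0)
  (m_bd : forall a b n z, d n (m a b n.+1 z)
    = m a.-1 b n (d1 a b z) + (-1) ^+ a *: m a b.-1 n (d2 a b z)).

(** A Leibniz rule for the inclusions yields one for the projections. It serves the total complex
    and also the paths on the disjoint union of the vertex sets; there not every chain is the sum of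
    its components, hence the hypothesis on this one [x]. *)
Lemma bigraded_proj_bd n a b x :
  x = \sum_(i < n.+2) m i (n.+1 - i) n.+1 (p i (n.+1 - i) n.+1 x) ->
  p a b n (d n x) = d1 a.+1 b (p a.+1 b n.+1 x)
                    + (-1) ^+ a *: d2 a b.+1 (p a b.+1 n.+1 x).
Proof.
move=> xE; have [ab|ab] := eqVneq (a + b)%N n; last first.
  rewrite !p_out ?linear0 ?scaler0 ?addr0 //; apply/eqP;
    by rewrite ?addnS ?addSn ?eqSS.
pose F i j : T a b := p a b n (m i.-1 j n (d1 i j (p i j n.+1 x))).
pose H i j : T a b :=
  (-1) ^+ i *: p a b n (m i j.-1 n (d2 i j (p i j n.+1 x))).
have an : (a < n.+1)%N by rewrite -ab ltnS leq_addr.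
transitivity (\sum_(i < n.+2) (F i (n.+1 - i)%N + H i (n.+1 - i)%N)).
  rewrite [in LHS]xE !linear_sum; apply: eq_bigr => i _.
  by rewrite m_bd linearD linearZ_LR.
(* The first sum loses its term i = 0 and the second its term i = n + 1, where a differential starts
   in degree 0; of the rest, orthogonality keeps i = a + 1 and i = a. *)
rewrite big_split /=; congr (_ + _).
  rewrite big_ord_recl {1}/F d1_0 !linear0 add0r.
  rewrite (big_only1 (Ordinal an)) //= => [|i ia _]; last first.
    rewrite /F m_orth // => ai; case/eqP: ia; apply: val_inj => /=.
    by rewrite ai.
  have -> : bump 0 a = a.+1 by [].
  have -> : (n.+1 - a.+1)%N = b by rewrite subSS -ab addKn.
  by rewrite /F mK.
rewrite big_ord_recr /= {2}/H subnn d2_0 !linear0 addr0.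
rewrite (big_only1 (Ordinal an)) //= => [|i ia _]; last first.
  rewrite /H m_orth ?scaler0 // => ai; case/eqP: ia; apply: val_inj => /=.
  by rewrite ai.
have -> : (n.+1 - a)%N = b.+1 by rewrite -ab -addnS addKn.
by rewrite /H mK.
Qed.
End Bigraded.

Section Complexes.
Variable R : comNzRingType.
Implicit Types C D E : chain_complex R.

(** In degree 0 this is the zero map from degree 0 to itself, a default that lets formulas in two
    degrees hold without cases. *)
Definition pbd C n : {linear chains C n -> chains C n.-1} :=
  match n return {linear chains C n -> chains C n.-1} with
  | 0 => \0
  | m.+1 => bd C m
  end.

Lemma cycleE C n x : (x \in cycle_pred C n) = (pbd C n x == 0).
Proof. by case: n x => [|n] x //=; rewrite eqxx. Qed.

Definition cycles C n : lmodType R := submod (cycle_pred C n).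
Definition boundaries C n : lmodType R := submod (boundary_pred C n).
Definition cycle_incl C n : {linear cycles C n -> chains C n} := submod_incl _.
Definition boundary_incl C n : {linear boundaries C n -> cycles C n} :=
  submod_incl _.
Definition hclass C n : {linear cycles C n -> homology C n} := quo _.

Lemma hclass_surj C n (h : homology C n) : exists z, hclass C n z = h.
Proof. by exists (repr h); apply: quoK. Qed.

Lemma hclass_eq0 C n (z : cycles C n) :
  hclass C n z = 0 <-> exists x, bd C n x = cycle_incl C n z.
Proof.
by rewrite /hclass quo_eq0; split=> [/asboolP|h] //; apply/asboolP.
Qed.

Lemma hclass_boundary C n (b : boundaries C n) :
  hclass C n (boundary_incl C n b) = 0.
Proof. exact/quo_eq0/(valP b). Qed.

Lemma hclass_eq0_boundary C n (z : cycles C n) :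
  hclass C n z = 0 -> exists b, boundary_incl C n b = z.
Proof. by move/quo_eq0 => h; exists (Submod h). Qed.

Lemma pbd_cycle C n (z : cycles C n) : pbd C n (cycle_incl C n z) = 0.
Proof. by have := valP z; rewrite cycleE => /eqP. Qed.

Lemma bd_cycle C n x : bd C n x \in cycle_pred C n.
Proof. by rewrite cycleE; case: n x => [|n] x //=; rewrite bd_bd. Qed.

Lemma bd_boundary C n x : Submod (bd_cycle x) \in boundary_pred C n.
Proof. by apply/asboolP; exists x. Qed.

Definition cobd C n : {linear chains C n.+1 -> boundaries C n} :=
  corestrict (f := corestrict (@bd_cycle C n)) (@bd_boundary C n).

Lemma cobdE C n x : cycle_incl C n (boundary_incl C n (cobd C n x)) = bd C n x.
Proof. by []. Qed.

Lemma cobd_eq0 C n x : bd C n x = 0 -> cobd C n x = 0.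
Proof. by move=> h; do 2! apply: val_inj. Qed.

Lemma cobd_surj C n (b : boundaries C n) : exists x, cobd C n x = b.
Proof.
by have /asboolP[x xE] := valP b; exists x; do 2! apply: val_inj.
Qed.

Lemma cobd_cycle C n (z : cycles C n.+1) : cobd C n (cycle_incl C n.+1 z) = 0.
Proof. by apply: cobd_eq0; apply: (pbd_cycle z). Qed.

Lemma cycle_incl_inj C n : injective (cycle_incl C n).
Proof. exact: val_inj. Qed.

Lemma boundary_incl_inj C n : injective (boundary_incl C n).
Proof. exact: val_inj. Qed.
End Complexes.
Arguments cobd : simpl never.
Arguments hclass : simpl never.

(* Over a PID submodules of free modules are free, so a free complex splits as
   C_n = Z_n (+) B_(n-1). lam starts a comparison of the free resolution
   B_n -> Z_n of H_n with the canonical one used to define Tor. *)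
Record cx_split (R : comNzRingType) (C : chain_complex R) := CxSplit {
  cyc : forall n, {linear chains C n -> cycles C n};
  cycK : forall n z, cyc n (cycle_incl C n z) = z;
  sect : forall n, {linear boundaries C n -> chains C n.+1};
  sectK : forall n b, cobd C n (sect n b) = b;
  cyc_sect : forall n x,
    cycle_incl C n.+1 (cyc n.+1 x) + sect n (cobd C n x) = x;
  lam : forall n, {linear cycles C n -> {freeg (homology C n) / R}};
  lamE : forall n z, free_cover (homology C n) (lam n z) = hclass C n z
}.

Lemma cx_split_exists (R : idomainType) (C : chain_complex R) :
  principal_ideal_domain R -> (forall n, separated (chains C n)) ->
  inhabited (cx_split C).
Proof.
move=> R_pid Cs.
have Zp n : fproj (cycles C n).
  apply: (fproj_inj R_pid (j := cycle_incl C n)) (Cs n) => z z0.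
  exact: val_inj.
have Bp n : fproj (boundaries C n).
  apply: (fproj_inj R_pid (j := cycle_incl C n \o boundary_incl C n)) (Cs n).
  by move=> z z0; do 2! apply: val_inj.
have hs n : exists s : {linear boundaries C n -> chains C n.+1},
    forall b, cobd C n (s b) = b.
  apply: (fproj_lift (f := lin_id _) (Bp n)) => b; exact: cobd_surj.
have hl n : exists l : {linear cycles C n -> {freeg (homology C n) / R}},
    forall z, free_cover (homology C n) (l z) = hclass C n z.
  (* Cycles are projective, so pointwise preimages suffice for a linear lift; here the preimage is
     the generator attached to the class. *)
  apply: (fproj_lift (Zp n)) => z; exists (free_gen R (hclass C n z)).
  exact: free_liftE.
pose s n := sval (cid (hs n)); pose l n := sval (cid (hl n)).
have sK n b : cobd C n (s n b) = b by rewrite /s; case: cid.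
have lE n z : free_cover (homology C n) (l n z) = hclass C n z.
  by rewrite /l; case: cid.
(* The cycle part of [x] is what remains after removing the section of its boundary. *)
have pS n x : x - s n (cobd C n x) \in cycle_pred C n.+1.
  rewrite cycleE linearB -[X in X - _]cobdE.
  by rewrite -[X in _ - X]cobdE sK subrr.
have pl n : linear (fun x => Submod (pS n x)).
  move=> a x y; apply: val_inj.
  rewrite -[LHS]/(a *: x + y - s n (cobd C n (a *: x + y))).
  rewrite (linearP (cobd C n)) (linearP (s n)).
  rewrite -[RHS]/(a *: (x - s n (cobd C n x)) + (y - s n (cobd C n y))).
  by rewrite scalerBr opprD addrACA.
pose p0 (x : chains C 0) : cycles C 0 := Submod (isT : x \in cycle_pred C 0).
have p0l : linear p0 by move=> a x y; apply: val_inj.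
pose p n : {linear chains C n -> cycles C n} :=
  match n return {linear chains C n -> cycles C n} with
  | 0 => linmap p0l
  | m.+1 => linmap (pl m)
  end.
split; apply: (@CxSplit R C p _ s sK _ l lE) => [[|n] z|n x].
- exact: val_inj.
- apply: val_inj; rewrite -[LHS]/(val z - s n (cobd C n (cycle_incl C n.+1 z))).
  by rewrite cobd_cycle linear0 subr0.
- exact: subrK.
Qed.

Section Split.
Variables (R : comNzRingType) (C : chain_complex R) (S : cx_split C).

Definition rho n : {linear chains C n -> homology C n} := hclass C n \o cyc S n.

Lemma rho_cycle n z : rho n (cycle_incl C n z) = hclass C n z.
Proof. by rewrite -[LHS]/(hclass C n (cyc S n _)) cycK. Qed.

Lemma rho_bd n x : rho n (bd C n x) = 0.
Proof. by rewrite -cobdE rho_cycle hclass_boundary. Qed.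

Fact lamB_subproof n (b : boundaries C n) :
  lam S n (boundary_incl C n b) \in ker_pred (free_cover (homology C n)).
Proof. by apply/eqP; rewrite lamE hclass_boundary. Qed.

Definition lamB n : {linear boundaries C n -> syzygy (homology C n)} :=
  corestrict (f := lam S n \o boundary_incl C n) (@lamB_subproof n).

Definition theta n : {linear chains C n.+1 -> syzygy (homology C n)} :=
  lamB n \o cobd C n.

Lemma lamBE n b :
  syzygy_incl (homology C n) (lamB n b) = lam S n (boundary_incl C n b).
Proof. by []. Qed.

Lemma theta_cycle n z : theta n (cycle_incl C n.+1 z) = 0.
Proof. by rewrite -[LHS]/(lamB n (cobd C n _)) cobd_cycle linear0. Qed.

Lemma theta_bd n x : theta n (bd C n.+1 x) = 0.
Proof. by rewrite -cobdE theta_cycle. Qed.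

Lemma syzygy_thetaE n x :
  syzygy_incl (homology C n) (theta n x) = lam S n (cyc S n (bd C n x)).
Proof. by rewrite -cobdE cycK. Qed.
End Split.
Arguments rho : simpl never.
Arguments theta : simpl never.
Arguments lamB : simpl never.

(** * The Kunneth maps *)

(* E is the total complex of C (x) D, with inclusions tm and projections tp of the
   summands. The degrees a, b, n are independent and the maps vanish unless
   a + b = n, so that no transport along equalities of degrees is needed. *)
Record tot_data (R : comNzRingType) (C D E : chain_complex R) := TotData {
  tm : forall a b n, {linear tensor (chains C a) (chains D b) -> chains E n};
  tp : forall a b n, {linear chains E n -> tensor (chains C a) (chains D b)};
  tmK : forall a b n z, (a + b)%N = n -> tp a b n (tm a b n z) = z;
  tm_orth : forall a b a' b' n z, a <> a' -> tp a b n (tm a' b' n z) = 0;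
  tm_out : forall a b n z, (a + b)%N <> n -> tm a b n z = 0;
  tp_out : forall a b n x, (a + b)%N <> n -> tp a b n x = 0;
  tm_sum : forall n x, x = \sum_(i < n.+1) tm i (n - i) n (tp i (n - i) n x);
  tm_bd : forall a b n z, bd E n (tm a b n.+1 z)
    = tm a.-1 b n (tensor_map (pbd C a) (lin_id _) z)
      + (-1) ^+ a *: tm a b.-1 n (tensor_map (lin_id _) (pbd D b) z)
}.

Section Total.
Variables (R : comNzRingType) (C D E : chain_complex R) (K : tot_data C D E).

Lemma tp_bd n a b x : tp K a b n (bd E n x)
  = tensor_map (bd C a) (lin_id _) (tp K a.+1 b n.+1 x)
    + (-1) ^+ a *: tensor_map (lin_id _) (bd D b) (tp K a b.+1 n.+1 x).
Proof.
apply: (@bigraded_proj_bd R (fun a b => tensor (chains C a) (chains D b))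
  (chains E) (fun a b => tensor_map (pbd C a) (lin_id _))
  (fun a b => tensor_map (lin_id _) (pbd D b)) (tm K) (tp K) (bd E)).
- by move=> *; apply: tensor_map0l.
- by move=> *; apply: tensor_map0r.
- exact: tmK.
- exact: tm_orth.
- exact: tp_out.
- exact: tm_bd.
- exact: tm_sum.
Qed.

(** In a cycle of the total complex the two contributions to bidegree (a, b) cancel. This trades a
    differential on the left factor for one on the right, where [rho] or another differential kills
    it; exactness and naturality both rest on this exchange. *)
Lemma tp_cycle n a b (x : cycles E n.+1) :
  tensor_map (bd C a) (lin_id _) (tp K a.+1 b n.+1 (cycle_incl E n.+1 x))
  = - (-1) ^+ a *: tensor_map (lin_id _) (bd D b)
                     (tp K a b.+1 n.+1 (cycle_incl E n.+1 x)).
Proof.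
apply/eqP; rewrite scaleNr -addr_eq0 -tp_bd; apply/eqP.
by rewrite -[bd E n _]/(pbd E n.+1 _) pbd_cycle linear0.
Qed.

Section Cross.
Variables a b n : nat.

Fact cross_subproof (t : tensor (cycles C a) (cycles D b)) :
  tm K a b n (tensor_map (cycle_incl C a) (cycle_incl D b) t) \in cycle_pred E n.
Proof.
case: n => [|m] //; rewrite cycleE -[pbd E m.+1 _]/(bd E m _) tm_bd.
rewrite !tensor_map_comp tensor_map0l ?tensor_map0r ?linear0 ?addr0 //.
  exact: pbd_cycle.
exact: pbd_cycle.
Qed.

Definition cross : {linear tensor (cycles C a) (cycles D b) -> cycles E n} :=
  corestrict (f := tm K a b n \o tensor_map (cycle_incl C a) (cycle_incl D b))
    cross_subproof.

Lemma crossE t : cycle_incl E n (cross t)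
  = tm K a b n (tensor_map (cycle_incl C a) (cycle_incl D b) t).
Proof. by []. Qed.
End Cross.
Arguments cross : simpl never.

Lemma cross_bd_l a b n (z : cycles C a) (w : cycles D b) :
  hclass C a z = 0 -> hclass E n (cross a b n (tens z w)) = 0.
Proof.
move=> /hclass_eq0[x xz]; apply/hclass_eq0.
exists (tm K a.+1 b n.+1 (tens x (cycle_incl D b w))).
rewrite tm_bd !tensor_mapE pbd_cycle tens0r linear0 scaler0 addr0.
by rewrite crossE tensor_mapE -xz.
Qed.

Lemma cross_bd_r a b n (z : cycles C a) (w : cycles D b) :
  hclass D b w = 0 -> hclass E n (cross a b n (tens z w)) = 0.
Proof.
move=> /hclass_eq0[y yw]; apply/hclass_eq0.
exists ((-1) ^+ a *: tm K a b.+1 n.+1 (tens (cycle_incl C a z) y)).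
rewrite linearZ_LR tm_bd !tensor_mapE pbd_cycle tens0l linear0 add0r.
by rewrite scalerA -expr2 sqrr_sign scale1r crossE tensor_mapE -yw.
Qed.

Definition alpha_fun a b n (h : homology C a) (k : homology D b) : homology E n :=
  hclass E n (cross a b n (tens (repr h : cycles C a) (repr k : cycles D b))).

Lemma alpha_funE a b n z w : alpha_fun n (hclass C a z) (hclass D b w)
  = hclass E n (cross a b n (tens z w)).
Proof.
apply/eqP; rewrite -subr_eq0 -(linearB (hclass E n)) -(linearB (cross a b n)).
set z' := repr _; set w' := repr _.
(* Changing one representative at a time leaves two terms, each with a factor of class zero. *)
have -> : tens (z' : cycles C a) (w' : cycles D b) - tens z w
    = tens (z' - z) w' + tens z (w' - w).
  by rewrite tensBl tensBr addrA subrK.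
rewrite (linearD (cross a b n)) (linearD (hclass E n)); apply/eqP.
by rewrite cross_bd_l ?cross_bd_r ?addr0 // linearB; apply/eqP;
  rewrite subr_eq0; apply/eqP/quoK.
Qed.

Fact alpha_linear_l a b n k : linear (fun h => @alpha_fun a b n h k).
Proof.
move=> c h h'; have [w <-] := hclass_surj k.
have [[z <-] [z' <-]] := (hclass_surj h, hclass_surj h').
rewrite -(linearP (hclass C a)) !alpha_funE -(linearP (hclass E n)).
by rewrite -(linearP (cross a b n)) tensDl tensZl.
Qed.

Fact alpha_linear_r a b n h : linear (@alpha_fun a b n h).
Proof.
move=> c k k'; have [z <-] := hclass_surj h.
have [[w <-] [w' <-]] := (hclass_surj k, hclass_surj k').
rewrite -(linearP (hclass D b)) !alpha_funE -(linearP (hclass E n)).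
by rewrite -(linearP (cross a b n)) tensDr tensZr.
Qed.

Definition alpha a b n :
    {linear tensor (homology C a) (homology D b) -> homology E n} :=
  tensor_lift (@alpha_linear_l a b n) (@alpha_linear_r a b n).

Lemma alphaE a b n t : alpha a b n (tensor_map (hclass C a) (hclass D b) t)
  = hclass E n (cross a b n t).
Proof.
have e : alpha a b n \o tensor_map (hclass C a) (hclass D b)
    =1 hclass E n \o cross a b n.
  apply: tensor_ext => z w.
  rewrite -[LHS]/(alpha a b n (tensor_map _ _ (tens z w))) tensor_mapE.
  by rewrite tensor_liftE alpha_funE.
exact: e.
Qed.

Variables (SC : cx_split C) (SD : cx_split D).

Section Gamma.
Variables a b n : nat.

Let gamma_cyc : {linear cycles E n -> tensor (homology C a) (homology D b)} :=
  (tensor_map (rho SC a) (rho SD b) \o tp K a b n) \o cycle_incl E n.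

Fact gamma_subproof : {in boundary_pred E n, forall z, gamma_cyc z = 0}.
Proof.
move=> z /asboolP[x xz].
rewrite -[LHS]/(tensor_map (rho SC a) (rho SD b) (tp K a b n (val z))) -xz.
rewrite tp_bd linearD linearZ_LR !tensor_map_comp.
by rewrite tensor_map0l ?tensor_map0r ?scaler0 ?addr0 // => y; apply: rho_bd.
Qed.

Definition gamma : {linear homology E n -> tensor (homology C a) (homology D b)} :=
  quo_lift gamma_subproof.

Lemma gammaE z : gamma (hclass E n z)
  = tensor_map (rho SC a) (rho SD b) (tp K a b n (cycle_incl E n z)).
Proof. exact: quo_liftE. Qed.
End Gamma.

Lemma gammaK a b n t : (a + b)%N = n -> gamma a b n (alpha a b n t) = t.
Proof.
move=> abn; have e : gamma a b n \o alpha a b n =1 lin_id _.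
  apply: tensor_ext => h k.
  have [[z <-] [w <-]] := (hclass_surj h, hclass_surj k).
  rewrite -tensor_mapE -[LHS]/(gamma a b n (alpha a b n _)).
  rewrite alphaE gammaE crossE tmK // !tensor_mapE.
  by rewrite !rho_cycle.
exact: e.
Qed.

Lemma gamma_orth a b a' b' n t :
  a <> a' -> gamma a b n (alpha a' b' n t) = 0.
Proof.
move=> aa; have e : gamma a b n \o alpha a' b' n =1 (\0 : {linear _ -> _}).
  apply: tensor_ext => h k.
  have [[z <-] [w <-]] := (hclass_surj h, hclass_surj k).
  rewrite -tensor_mapE -[LHS]/(gamma a b n (alpha a' b' n _)).
  by rewrite alphaE gammaE crossE tm_orth // linear0.
exact: e.
Qed.

Section Beta.
Variables a b n : nat.

Let th : {linear chains E n.+1 -> tensor (syzygy (homology C a)) (homology D b)} :=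
  tensor_map (theta SC a) (rho SD b) \o tp K a.+1 b n.+1.

Fact beta_subproof (z : cycles E n.+1) : th (cycle_incl E n.+1 z)
  \in ker_pred (tensor_map (syzygy_incl (homology C a)) (lin_id (homology D b))).
Proof.
apply/eqP; rewrite tensor_map_comp.
pose l := lam SC a \o cyc SC a.
rewrite (@eq_tensor_map _ _ _ _ _ _ (l \o bd C a) _ (rho SD b \o lin_id _));
  last 2 first.
- exact: syzygy_thetaE.
- by [].
rewrite -tensor_map_comp tp_cycle linearZ_LR tensor_map_comp.
by rewrite tensor_map0r ?scaler0 // => y; apply: rho_bd.
Qed.

Definition beta_cyc : {linear cycles E n.+1 -> Tor (homology C a) (homology D b)} :=
  corestrict (f := th \o cycle_incl E n.+1) beta_subproof.

Fact beta_lift_subproof :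
  {in boundary_pred E n.+1, forall z, beta_cyc z = 0}.
Proof.
move=> z /asboolP[x xz]; apply: val_inj.
rewrite -[LHS]/(tensor_map (theta SC a) (rho SD b) (tp K a.+1 b n.+1 (val z))).
rewrite -xz tp_bd linearD linearZ_LR !tensor_map_comp.
rewrite tensor_map0l ?tensor_map0r ?scaler0 ?addr0 // => y.
  exact: rho_bd.
exact: theta_bd.
Qed.

(* theta (x) rho is zero on boundaries, and on cycles its composite with
   syzygy (x) H -> free (x) H factors through rho o bd = 0. *)
Definition beta :
    {linear homology E n.+1 -> Tor (homology C a) (homology D b)} :=
  quo_lift beta_lift_subproof.

Lemma betaE z : val (beta (hclass E n.+1 z))
  = tensor_map (theta SC a) (rho SD b) (tp K a.+1 b n.+1 (cycle_incl E n.+1 z)).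
Proof. exact: (congr1 val (quo_liftE beta_lift_subproof z)). Qed.
End Beta.

(** A cross product has a component only in its own bidegree, and there [theta] meets a cycle on the
    left. *)
Lemma beta_alpha a b a' b' n t : beta a b n (alpha a' b' n.+1 t) = 0.
Proof.
suff e : beta a b n \o alpha a' b' n.+1 =1 (\0 : {linear _ -> _}) by exact: e.
clear t; apply: tensor_ext => h k.
have [[z <-] [w <-]] := (hclass_surj h, hclass_surj k); clear h k.
rewrite -tensor_mapE -[LHS]/(beta a b n (alpha a' b' n.+1 _)).
apply: val_inj; rewrite alphaE betaE crossE.
have [aa|] := eqVneq a.+1 a'; last first.
  by move=> /eqP aa; rewrite tm_orth // linear0.
rewrite -{a'}aa in z *; rewrite tensor_mapE.
have [bn|] := eqVneq (a.+1 + b)%N n.+1; last first.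
  by move=> /eqP bn; rewrite tp_out // linear0.
have [bb|] := eqVneq b b'; last first.
  move=> /eqP bb; rewrite tm_out ?linear0 // -bn.
  by move/addnI/esym.
rewrite -{b'}bb in w *; rewrite tmK // tensor_mapE.
by rewrite -/(cycles C a.+1) theta_cycle tens0l.
Qed.
End Total.

(** * Exactness *)

Section TorPresentation.
Variables (R : comNzRingType) (C : chain_complex R) (S : cx_split C).
Variables (n : nat) (N : lmodType R).

(** A comparison in the direction opposite to [lam]: any choice of representatives extends linearly,
    the source being free on all homology classes. *)
Definition mu : {linear {freeg (homology C n) / R} -> cycles C n} :=
  free_lift (fun h => repr h).

Lemma hclass_mu f : hclass C n (mu f) = free_cover (homology C n) f.
Proof.
have e : hclass C n \o mu =1 free_cover (homology C n).
  apply: free_ext => h; rewrite -[LHS]/(hclass C n (mu (free_gen R h))).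
  rewrite !free_liftE; exact: quoK.
exact: e.
Qed.

Fact muB_subproof s : mu (syzygy_incl (homology C n) s) \in boundary_pred C n.
Proof. by apply/quo_eq0; rewrite [LHS]hclass_mu; apply/eqP/(valP s). Qed.

Definition muB : {linear syzygy (homology C n) -> boundaries C n} :=
  corestrict (f := mu \o syzygy_incl _) muB_subproof.

Lemma muBE s : boundary_incl C n (muB s) = mu (syzygy_incl _ s).
Proof. by []. Qed.

Fact cycle_defect_subproof z :
  (lin_id _ \- (mu \o lam S n)) z \in boundary_pred C n.
Proof.
apply/quo_eq0; rewrite -[LHS]/(hclass C n (z - mu (lam S n z))).
by rewrite linearB hclass_mu lamE subrr.
Qed.

Fact syzygy_defect_subproof f :
  (lin_id _ \- (lam S n \o mu)) f \in ker_pred (free_cover (homology C n)).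
Proof.
apply/eqP; rewrite -[LHS]/(free_cover _ (f - lam S n (mu f))).
by rewrite linearB lamE hclass_mu subrr.
Qed.

(* Both presentations B_n -> Z_n and syzygy -> free module of H_n compute the
   same Tor: the composites of lamB and muB differ from the identity by maps
   that factor through the inclusion of the relations. *)
Lemma lamB_inj (t : tensor (boundaries C n) N) :
  tensor_map (boundary_incl C n) (lin_id N) t = 0 ->
  tensor_map (lamB S n) (lin_id N) t = 0 -> t = 0.
Proof.
move=> t1 t2; rewrite -[t](tensor_map_id (f := lin_id _) (g := lin_id N)) //.
pose eta := corestrict cycle_defect_subproof.
rewrite (@tensor_mapDl _ _ _ _ _ _ (eta \o boundary_incl C n)
  (muB \o lamB S n)); last first.
  move=> b; apply: boundary_incl_inj; rewrite linearD.
  rewrite -[X in X + _]/(boundary_incl C n b - mu (lam S n (boundary_incl C n b))).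
  by rewrite [X in _ + X]muBE lamBE subrK.
rewrite (@eq_tensor_map _ _ _ _ _ _ (eta \o boundary_incl C n) _
  (lin_id _ \o lin_id N)) //.
rewrite -tensor_map_comp t1 linear0 add0r.
by rewrite -(tensor_map_comp muB (lin_id N)) t2 linear0.
Qed.

Lemma lamB_muB (t : Tor (homology C n) N) :
  tensor_map (lamB S n) (lin_id N) (tensor_map muB (lin_id N) (val t)) = val t.
Proof.
rewrite tensor_map_comp -[RHS](tensor_map_id (f := lin_id _) (g := lin_id N)) //.
pose eta := corestrict syzygy_defect_subproof.
rewrite [RHS](@tensor_mapDl _ _ _ _ _ _ (eta \o syzygy_incl _)
  (lamB S n \o muB)); last first.
  move=> s; apply: val_inj.
  rewrite -[RHS]/(syzygy_incl _ s - lam S n (mu (syzygy_incl _ s))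
                  + lam S n (mu (syzygy_incl _ s))).
  by rewrite subrK.
rewrite -[X in _ = X + _](tensor_map_comp _ (lin_id N)).
have /eqP -> := valP t; rewrite linear0 add0r.
exact: eq_tensor_map.
Qed.

Lemma boundary_incl_muB (t : Tor (homology C n) N) :
  tensor_map (boundary_incl C n) (lin_id N) (tensor_map muB (lin_id N) (val t))
  = 0.
Proof.
rewrite tensor_map_comp.
rewrite (@eq_tensor_map _ _ _ _ _ _ (mu \o syzygy_incl _) _ (lin_id N \o lin_id N)) //.
by rewrite -tensor_map_comp; have /eqP -> := valP t; rewrite linear0.
Qed.
End TorPresentation.
Arguments mu : simpl never.
Arguments muB : simpl never.

Section Split.
Variables (R : comNzRingType) (C : chain_complex R) (S : cx_split C).

Definition cpart n : {linear chains C n -> chains C n} :=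
  cycle_incl C n \o cyc S n.

(** The projector complementary to [cpart]; it vanishes in degree 0, where every chain is a
    cycle. *)
Definition spart n : {linear chains C n -> chains C n} :=
  match n return {linear chains C n -> chains C n} with
  | 0 => \0
  | m.+1 => sect S m \o cobd C m
  end.

Lemma cspart n x : x = cpart n x + spart n x.
Proof.
case: n x => [|n] x; last by rewrite -[RHS]/(_ + _) cyc_sect.
rewrite addr0 -[RHS]/(cycle_incl C 0 (cyc S 0 x)).
have -> : x = cycle_incl C 0 (Submod (isT : x \in cycle_pred C 0)) by [].
by rewrite cycK.
Qed.

Lemma bd_sect n b : bd C n (sect S n b) = cycle_incl C n (boundary_incl C n b).
Proof. by rewrite -cobdE sectK. Qed.

Lemma cpart_bd n x : cpart n (bd C n x) = bd C n x.
Proof. by rewrite -[LHS]/(cycle_incl C n (cyc S n _)) -cobdE cycK. Qed.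

Lemma cycle_kill n (N : lmodType R) (f : {linear chains C n.+1 -> N}) x :
  (forall z, f (cycle_incl C n.+1 z) = 0) -> f (sect S n (cobd C n x)) = f x.
Proof. by move=> f0; rewrite -[x in RHS](cyc_sect S) linearD f0 add0r. Qed.

Lemma bd_eq0_kill n (N : lmodType R) (f : {linear chains C n.+1 -> N}) x :
  (forall z, f (cycle_incl C n.+1 z) = 0) -> bd C n x = 0 -> f x = 0.
Proof. by move=> f0 /cobd_eq0 x0; rewrite -cycle_kill // x0 !linear0. Qed.
End Split.
Arguments cpart : simpl never.
Arguments spart : simpl never.

Section Exactness.
Variables (R : idomainType) (C D E : chain_complex R) (K : tot_data C D E).
Hypotheses (R_pid : principal_ideal_domain R)
  (Cs : forall n, separated (chains C n)) (Ds : forall n, separated (chains D n)).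
Variables (SC : cx_split C) (SD : cx_split D).

Lemma fproj_chains (F : chain_complex R) n :
  separated (chains F n) -> fproj (chains F n).
Proof. exact: separated_fproj. Qed.

Lemma fproj_cycles (F : chain_complex R) n :
  separated (chains F n) -> fproj (cycles F n).
Proof. by apply: (fproj_inj R_pid (j := cycle_incl F n)) => z z0; apply: val_inj. Qed.

Lemma fproj_boundaries (F : chain_complex R) n :
  separated (chains F n) -> fproj (boundaries F n).
Proof.
apply: (fproj_inj R_pid (j := cycle_incl F n \o boundary_incl F n)) => z z0.
by do 2! apply: val_inj.
Qed.

(** A cycle of the total complex has no part in B (x) B. Indeed [tp_cycle] gives (bd (x) bd) x = 0;
    flatness of D_b turns the left [bd] into [cobd], flatness of B_a turns the right one into [g],
    and [f] factors through [cobd]. *)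
Lemma tp_cycle_kill n a b (z : cycles E n.+1) (P Q : lmodType R)
    (f : {linear chains C a.+1 -> P}) (g : {linear chains D b.+1 -> Q}) :
  (forall x, f (cycle_incl C _ x) = 0) -> (forall x, g (cycle_incl D _ x) = 0) ->
  tensor_map f g (tp K a.+1 b.+1 n.+1 (cycle_incl E n.+1 z)) = 0.
Proof.
move=> f0 g0; set x := tp _ _ _ _ _.
have bb : tensor_map (bd C a) (lin_id _) (tensor_map (lin_id _) (bd D b) x) = 0.
  rewrite (@tensor_map_square _ _ _ _ _ _ _ _ _ _ _ _ _ (lin_id _) (bd D b)
    (bd C a) (lin_id _)) // tp_cycle linearZ_LR tensor_map_comp.
  by rewrite tensor_map0r ?scaler0 // => y; apply: bd_bd.
have cb : tensor_map (lin_id _) (bd D b) (tensor_map (cobd C a) (lin_id _) x) = 0.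
  rewrite (@tensor_map_square _ _ _ _ _ _ _ _ _ _ _ _ _ (cobd C a) (lin_id _)
    (lin_id _) (bd D b)) //.
  by apply: (fproj_flat_l (fproj_chains (Ds b))) bb => y; apply: cobd_eq0.
have cg : tensor_map (lin_id _) g (tensor_map (cobd C a) (lin_id _) x) = 0.
  apply: (fproj_flat (fproj_boundaries (Cs a))) cb => y.
  exact: (bd_eq0_kill SD).
rewrite (@eq_tensor_map _ _ _ _ _ _ ((f \o sect SC a) \o cobd C a) _
  (lin_id _ \o g)) //; last first.
  by move=> y; rewrite -[RHS]/(f (sect SC a (cobd C a y))) cycle_kill.
rewrite -tensor_map_comp (_ : tensor_map (cobd C a) g x = 0) ?linear0 //.
by rewrite -cg tensor_map_comp; apply: eq_tensor_map.
Qed.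

(* As theta (x) rho kills x, the part of x in (section of B_a) (x) Z_b comes from
   w in B_a (x) B_b; lifting w along both differentials gives an element whose
   boundary is this part plus, x being a cycle, the neighbouring one. *)
Lemma beta_kernel_step n a b (z : cycles E n.+1) :
  let x i j := tp K i j n.+1 (cycle_incl E n.+1 z) in
  beta K SC SD a b n (hclass E n.+1 z) = 0 ->
  exists y, bd E n.+1 y
    = tm K a.+1 b n.+1 (tensor_map (spart SC a.+1) (cpart SD b) (x a.+1 b))
      + tm K a b.+1 n.+1 (tensor_map (cpart SC a) (spart SD b.+1) (x a b.+1)).
Proof.
move=> x bz.
(* This element of B_a (x) H_b is zero by [lamB_inj]: its image under [lamB] vanishes by hypothesis,
   and its image in Z_a (x) H_b because a cycle is given. *)
have s0 : tensor_map (cobd C a) (rho SD b) (x a.+1 b) = 0.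
  apply: (lamB_inj (S := SC)); last first.
    have := congr1 val bz; rewrite betaE => bz'; rewrite tensor_map_comp.
    by apply: etrans bz'; apply: eq_tensor_map.
  rewrite tensor_map_comp.
  rewrite (@eq_tensor_map _ _ _ _ _ _ (cyc SC a \o bd C a) _ (rho SD b \o lin_id _)) //.
    rewrite -tensor_map_comp tp_cycle linearZ_LR tensor_map_comp.
    by rewrite tensor_map0r ?scaler0 // => y; apply: rho_bd.
  by move=> y; rewrite -[RHS]/(cyc SC a (bd C a y)) -cobdE cycK.
have [w wE] : exists w, tensor_map (lin_id _) (boundary_incl D b) w
    = tensor_map (cobd C a) (cyc SD b) (x a.+1 b).
  apply: (fproj_exact (fproj_boundaries (Cs a)) (g := hclass D b)).
    by move=> y; apply: hclass_eq0_boundary.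
  by rewrite tensor_map_comp -s0; apply: eq_tensor_map.
(* The sign cancels the one that [tm_bd] puts on the differential of the right factor. *)
exists ((-1) ^+ a.+1 *: tm K a.+1 b.+1 n.+2 (tensor_map (sect SC a) (sect SD b) w)).
rewrite linearZ_LR tm_bd scalerDr scalerA -expr2 sqrr_sign scale1r addrC.
congr (_ + _).
  congr (tm K a.+1 b n.+1 _); rewrite tensor_map_comp.
  rewrite (@eq_tensor_map _ _ _ _ _ _ (sect SC a \o lin_id _) _
    (cycle_incl D b \o boundary_incl D b)) //; last by move=> y; apply: bd_sect.
  by rewrite -tensor_map_comp wE tensor_map_comp; apply: eq_tensor_map.
rewrite -linearZ_LR; congr (tm K a b.+1 n.+1 _); rewrite tensor_map_comp.
pose iC := cycle_incl C a \o boundary_incl C a.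
pose iD := cycle_incl D b \o boundary_incl D b.
suff e : (-1) ^+ a.+1 *: tensor_map iC (lin_id _) w
    = tensor_map (cpart SC a) (cobd D b) (x a b.+1).
  rewrite (@eq_tensor_map _ _ _ _ _ _ (lin_id _ \o iC) _ (sect SD b \o lin_id _)) //;
    last by move=> y; apply: bd_sect.
  rewrite -tensor_map_comp -linearZ_LR e tensor_map_comp.
  exact: eq_tensor_map.
(* Both sides live in C_a (x) B_b. As C_a is flat they may be compared in C_a (x) D_b, where
   [tp_cycle] applies. *)
apply/eqP; rewrite -subr_eq0; apply/eqP; set t := _ - _.
rewrite -[t](tensor_map_id (f := lin_id _) (g := lin_id _)) //.
apply: (fproj_flat (fproj_chains (Cs a)) (f := iD)) => [y y0|].
  by do 2! apply: val_inj.
rewrite linearB linearZ_LR !tensor_map_comp.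
rewrite (@eq_tensor_map _ _ _ _ _ (lin_id _ \o iC) (iC \o lin_id _) _
  (cycle_incl D b \o boundary_incl D b)) //.
rewrite -(tensor_map_comp iC (cycle_incl D b)) wE !tensor_map_comp.
rewrite (@eq_tensor_map _ _ _ _ _ _ (cpart SC a \o bd C a) _ (cpart SD b \o lin_id _)) //;
  last by move=> y; rewrite -[RHS]/(cpart SC a (bd C a y)) cpart_bd.
rewrite -tensor_map_comp tp_cycle linearZ_LR tensor_map_comp scalerA.
rewrite exprS mulN1r mulrNN -expr2 sqrr_sign scale1r.
apply/eqP; rewrite subr_eq0; apply/eqP.
by apply: eq_tensor_map => // y; apply: cpart_bd.
Qed.

(** Each component of a cycle splits into four parts. The cycle-cycle parts give the right-hand
    side, the section-section parts vanish by [tp_cycle_kill], and the mixed parts of neighbouring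
    bidegrees (i + 1, n - i) and (i, n - i + 1) pair up into boundaries. *)
Lemma beta_kernel n (h : homology E n.+1) :
  (forall a b, (a + b)%N = n -> beta K SC SD a b n h = 0) ->
  h = \sum_(i < n.+2) alpha K i (n.+1 - i) n.+1
        (gamma K SC SD i (n.+1 - i) n.+1 h).
Proof.
have [z <-] := hclass_surj h => bz; apply/eqP; rewrite -subr_eq0.
pose x i j := tp K i j n.+1 (cycle_incl E n.+1 z).
pose W i j := cross K i j n.+1 (tensor_map (cyc SC i) (cyc SD j) (x i j)).
rewrite (eq_bigr (fun i : 'I_n.+2 => hclass E n.+1 (W i (n.+1 - i)%N))); last first.
  move=> i _; rewrite gammaE -alphaE; congr (alpha _ _ _ _ _).
  by rewrite tensor_map_comp.
rewrite -(linear_sum (hclass E n.+1)) -linearB; apply/eqP/hclass_eq0.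
pose F i j := tm K i j n.+1 (tensor_map (spart SC i) (cpart SD j) (x i j)).
pose G i j := tm K i j n.+1 (tensor_map (cpart SC i) (spart SD j) (x i j)).
have -> : cycle_incl E n.+1 (z - \sum_(i < n.+2) W i (n.+1 - i)%N)
    = \sum_(i < n.+1) (F i.+1 (n - i)%N + G i (n - i).+1).
  transitivity (\sum_(i < n.+2) (F i (n.+1 - i)%N + G i (n.+1 - i)%N)).
    rewrite linearB linear_sum [X in X - _](tm_sum K) -sumrB.
    apply: eq_bigr => i _; move: (nat_of_ord i) (n.+1 - i)%N => {i} i j.
    rewrite crossE tensor_map_comp.
    rewrite -[tp _ _ _ _ _](tensor_map_id (f := lin_id _) (g := lin_id _)) //.
    rewrite (@tensor_mapDl _ _ _ _ _ _ (cpart SC i) (spart SC i)); last exact: cspart.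
    rewrite !(@tensor_mapDr _ _ _ _ _ _ (lin_id _) (cpart SD j) (spart SD j));
      try exact: cspart.
    have -> : tensor_map (spart SC i) (spart SD j) (x i j) = 0.
      case: i j => [|i] [|j]; try by [exact: tensor_map0l | exact: tensor_map0r].
      by apply: tp_cycle_kill => y;
        rewrite -[LHS]/(sect _ _ (cobd _ _ _)) cobd_cycle linear0.
    rewrite addr0 !linearD [X in _ - X](_ : _ =
      tm K i j n.+1 (tensor_map (cpart SC i) (cpart SD j) (x i j))); last first.
      by congr (tm K i j n.+1 _); apply: eq_tensor_map.
    by rewrite -/(x i j) -[X in X - _]addrA [LHS]addrC addKr [LHS]addrC.
  (* [F] vanishes at i = 0 and [G] at i = n + 1, because [spart] is zero in degree 0; shifting [F]
     by one then forms the pairs. *)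
  rewrite !big_split /=; congr (_ + _).
    rewrite big_ord_recl {1}/F tensor_map0l // linear0 add0r.
    by apply: eq_bigr => i _; rewrite /= subSS.
  rewrite big_ord_recr /= subnn {2}/G tensor_map0r // linear0 addr0.
  by apply: eq_bigr => i _; rewrite subSn // -ltnS.
have h1 (i : 'I_n.+1) : exists y, bd E n.+1 y = F i.+1 (n - i)%N + G i (n - i).+1.
  by apply: beta_kernel_step; apply: bz; rewrite subnKC // -ltnS.
have [y yE] := fin_all_exists h1; exists (\sum_i y i).
by rewrite linear_sum; apply: eq_bigr.
Qed.

(** A zigzag: [t] gives [s] in B_a (x) H_b, lifted to [s'] in B_a (x) Z_b. The image of [s'] in Z_a
    (x) Z_b dies in Z_a (x) H_b, so it comes from [w] in Z_a (x) B_b, and the sections of [s'] and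
    [w] combine into a cycle. The vanishing for [a' <> a] allows preimages for different bidegrees
    to be added. *)
Lemma beta_surj n a b (t : Tor (homology C a) (homology D b)) : (a + b)%N = n ->
  exists h : homology E n.+1, beta K SC SD a b n h = t
    /\ forall a' b', a' <> a -> beta K SC SD a' b' n h = 0.
Proof.
move=> abn; pose s := tensor_map (muB C a) (lin_id _) (val t).
have [s' s'E] : exists s', tensor_map (lin_id _) (hclass D b) s' = s.
  by apply: (fproj_surj (fproj_boundaries (Cs a))); apply: hclass_surj.
have [w wE] : exists w, tensor_map (lin_id _) (boundary_incl D b) w
    = tensor_map (boundary_incl C a) (lin_id _) s'.
  apply: (fproj_exact (fproj_cycles (Cs a)) (g := hclass D b)).
    by move=> y; apply: hclass_eq0_boundary.
  rewrite (@tensor_map_square _ _ _ _ _ _ _ _ _ _ _ _ _ (boundary_incl C a)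
    (lin_id _) (lin_id _) (hclass D b)) // s'E.
  exact: boundary_incl_muB.
pose u := tensor_map (sect SC a) (cycle_incl D b) s'.
pose v := tensor_map (cycle_incl C a) (sect SD b) w.
pose x : chains E n.+1 := tm K a.+1 b n.+1 u - (-1) ^+ a *: tm K a b.+1 n.+1 v.
have xc : x \in cycle_pred E n.+1.
  rewrite cycleE -[pbd _ _ _]/(bd E n x) linearB linearZ_LR !tm_bd.
  rewrite /u /v !tensor_map_comp.
  rewrite [X in (_ + _ *: tm K a.+1 b.-1 n X) - _]tensor_map0r; last exact: pbd_cycle.
  rewrite [X in _ - _ *: (tm K a.-1 b.+1 n X + _)]tensor_map0l; last exact: pbd_cycle.
  rewrite !linear0 add0r addr0 scalerA -expr2 sqrr_sign scale1r subr_eq0.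
  apply/eqP; congr (tm K a b n _).
  rewrite (@eq_tensor_map _ _ _ _ _ _ (cycle_incl C a \o boundary_incl C a) _
    (cycle_incl D b \o lin_id _)) //; last by move=> y; apply: bd_sect.
  rewrite -tensor_map_comp -wE tensor_map_comp.
  by apply: eq_tensor_map => // y; rewrite -[RHS]/(bd D b (sect SD b y)) bd_sect.
exists (hclass E n.+1 (Submod xc)); split=> [|a' b' aa]; apply: val_inj; rewrite betaE.
  rewrite linearB linearZ_LR tmK ?addSn ?abn // tm_orth ?scaler0 ?subr0; last first.
    by move/eqP; rewrite eqn_leq ltnn.
  rewrite /u tensor_map_comp -[RHS](lamB_muB SC) -/s -s'E tensor_map_comp.
  apply: eq_tensor_map => y; last exact: rho_cycle.
  by rewrite -[LHS]/(lamB SC a (cobd C a (sect SC a y))) sectK.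
rewrite linearB linearZ_LR tm_orth ?sub0r; last by case.
rewrite linearN linearZ_LR.
suff -> : tensor_map (theta SC a') (rho SD b')
    (tp K a'.+1 b' n.+1 (tm K a b.+1 n.+1 v)) = 0.
  by rewrite scaler0 oppr0.
rewrite /v; clear x xc v u s s' s'E wE t aa.
(* The summand [v] can only be seen from a' + 1 = a, and there [theta] meets a cycle of C. *)
have [ea|] := eqVneq a'.+1 a; last by move=> /eqP na; rewrite tm_orth // linear0.
rewrite -{a}ea in abn w *.
have [eb|] := eqVneq b' b.+1; last first.
  by move=> /eqP nb; rewrite tp_out ?linear0 // -abn -addnS => /addnI.
rewrite eb tmK ?addnS ?abn // tensor_map_comp tensor_map0l // => y.
exact: theta_cycle.
Qed.
End Exactness.

(** * Naturality *)

Section Functoriality.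
Variables (R : comNzRingType) (C C' : chain_complex R) (f : chain_map C C').

Lemma homology_map_hclass n z :
  homology_map f n (hclass C n z) = hclass C' n (Defs.cycle_map f n z).
Proof. exact: quo_mapE. Qed.

Lemma cycle_map_incl n z :
  cycle_incl C' n (Defs.cycle_map f n z) = chain_map_fun f n (cycle_incl C n z).
Proof. by []. Qed.

Variables (S : cx_split C) (S' : cx_split C').

(** Both maps from cycles to the free cover lift the same map to homology. *)
Fact theta_defect_subproof n (z : cycles C n) :
  ((lam S' n \o Defs.cycle_map f n) \- (free_map R (homology_map f n) \o lam S n)) z
    \in ker_pred (free_cover (homology C' n)).
Proof.
apply/eqP; rewrite -[LHS]/(free_cover _ (lam S' n (Defs.cycle_map f n z)
  - free_map R (homology_map f n) (lam S n z))).
rewrite linearB lamE -homology_map_hclass -(lamE S).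
have e : free_cover (homology C' n) \o free_map R (homology_map f n)
    =1 homology_map f n \o free_cover (homology C n).
  apply: free_ext => k; rewrite -[LHS]/(free_cover _ (free_map _ _ (free_gen R k))).
  rewrite -[RHS]/(homology_map f n (free_cover _ (free_gen R k))).
  by rewrite free_mapE !free_liftE.
by rewrite -[X in _ - X]/((_ \o _) _) e subrr.
Qed.

Definition theta_defect n : {linear cycles C n -> syzygy (homology C' n)} :=
  corestrict (@theta_defect_subproof n).

(** [theta] commutes with chain maps only up to a term that factors through [bd], which [tp_cycle]
    can remove. *)
Lemma theta_chain_map n x : theta S' n (chain_map_fun f n.+1 x)
  = syzygy_map (homology_map f n) (theta S n x)
    + theta_defect n (cyc S n (bd C n x)).
Proof.
apply: val_inj; rewrite -[X in cyc S n X]cobdE cycK.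
rewrite -[RHS]/(free_map R (homology_map f n) (lam S n (boundary_incl C n (cobd C n x)))
   + (lam S' n (Defs.cycle_map f n (boundary_incl C n (cobd C n x)))
      - free_map R (homology_map f n) (lam S n (boundary_incl C n (cobd C n x))))).
rewrite addrC subrK.
rewrite -[LHS]/(lam S' n (boundary_incl C' n (cobd C' n (chain_map_fun f n.+1 x)))).
congr (lam S' n _); apply: cycle_incl_inj.
by rewrite cobdE cycle_map_incl cobdE chain_map_bd.
Qed.
End Functoriality.

Section TotalNaturality.
Variables (R : idomainType) (C C' D D' E E' : chain_complex R).
Variables (K : tot_data C D E) (K' : tot_data C' D' E').
Variables (f : chain_map C C') (g : chain_map D D') (e : chain_map E E').
Hypothesis tm_nat : forall a b n z, chain_map_fun e n (tm K a b n z)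
  = tm K' a b n (tensor_map (chain_map_fun f a) (chain_map_fun g b) z).

(** Only the inclusions are assumed natural; as every chain is the sum of its components, the
    projections follow. *)
Lemma tp_nat a b n x : tp K' a b n (chain_map_fun e n x)
  = tensor_map (chain_map_fun f a) (chain_map_fun g b) (tp K a b n x).
Proof.
have [abn|/eqP abn] := eqVneq (a + b)%N n; last by rewrite !tp_out ?linear0.
rewrite [in LHS](tm_sum K x) !linear_sum.
have an : (a < n.+1)%N by rewrite -abn ltnS leq_addr.
rewrite (big_only1 (Ordinal an)) // => [|i ia _]; last first.
  rewrite tm_nat tm_orth // => ai; case/eqP: ia; apply: val_inj => /=.
  by rewrite ai.
have nb : (n - a)%N = b by rewrite -abn addKn.
by rewrite -[nat_of_ord _]/a nb tm_nat tmK.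
Qed.

Lemma alpha_nat a b n t : homology_map e n (alpha K a b n t)
  = alpha K' a b n (tensor_map (homology_map f a) (homology_map g b) t).
Proof.
have h : homology_map e n \o alpha K a b n
    =1 alpha K' a b n \o tensor_map (homology_map f a) (homology_map g b).
  apply: tensor_ext => h k.
  have [[z <-] [w <-]] := (hclass_surj h, hclass_surj k); clear h k.
  rewrite -[LHS]/(homology_map e n (alpha K a b n _)).
  rewrite -[RHS]/(alpha K' a b n (tensor_map _ _ (tens _ _))) tensor_mapE.
  rewrite !homology_map_hclass -!tensor_mapE !alphaE homology_map_hclass.
  congr (hclass E' n _); apply: cycle_incl_inj.
  by rewrite cycle_map_incl !crossE tm_nat !tensor_mapE.
exact: h.
Qed.

Hypotheses (R_pid : principal_ideal_domain R)
  (Cs : forall n, separated (chains C n)) (Ds : forall n, separated (chains D n)).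
Variables (SC : cx_split C) (SC' : cx_split C')
  (SD : cx_split D) (SD' : cx_split D').

(** No compatibility is asked between the splittings on the two sides. The defect of [theta] factors
    through [bd] and dies by [tp_cycle]; the defect [dl] of [rho] kills cycles, as does [theta], so
    their tensor product dies by [tp_cycle_kill]. *)
Lemma beta_nat a b n h : beta K' SC' SD' a b n (homology_map e n.+1 h)
  = Tor_map (homology_map f a) (homology_map g b) (beta K SC SD a b n h).
Proof.
have [z <-] := hclass_surj h; apply: val_inj.
rewrite homology_map_hclass betaE cycle_map_incl tp_nat tensor_map_comp.
rewrite -[RHS]/(tensor_map (syzygy_map (homology_map f a)) (homology_map g b)
  (val (beta K SC SD a b n (hclass E n.+1 z)))).
rewrite betaE tensor_map_comp; set x := tp _ _ _ _ _.
pose th := syzygy_map (homology_map f a) \o theta SC a.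
pose rh := rho SD' b \o chain_map_fun g b.
rewrite (@tensor_mapDl _ _ _ _ _ _ th
  ((theta_defect f SC SC' a \o cyc SC a) \o bd C a)); last exact: theta_chain_map.
rewrite [X in _ + X](_ : _ = 0) ?addr0; last first.
  rewrite (@eq_tensor_map _ _ _ _ _ _ ((theta_defect f SC SC' a \o cyc SC a) \o bd C a)
    _ (rh \o lin_id _)) // -tensor_map_comp tp_cycle linearZ_LR tensor_map_comp.
  rewrite tensor_map0r ?scaler0 // => y.
  rewrite -[LHS]/(rho SD' b (chain_map_fun g b (bd D b y))) chain_map_bd.
  exact: rho_bd.
have [dl dlE] : exists dl : {linear chains D b -> homology D' b},
    forall y, dl y = rh y - homology_map g b (rho SD b y).
  by exists (rh \- (homology_map g b \o rho SD b)).
rewrite (@tensor_mapDr _ _ _ _ _ th rh (homology_map g b \o rho SD b) dl); last first.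
  by move=> y; rewrite dlE addrC subrK.
rewrite [X in _ + X](_ : _ = 0) ?addr0 //.
have dl0 y : dl (cycle_incl D b y) = 0.
  rewrite dlE -[rh _]/(rho SD' b (chain_map_fun g b (cycle_incl D b y))).
  by rewrite -cycle_map_incl !rho_cycle homology_map_hclass subrr.
(* [tp_cycle_kill] requires positive degrees on both sides; for b = 0 every chain is a cycle and
   [dl] itself is zero. *)
clear dlE rh; move: dl dl0 @x; case: b => [|b'] dl dl0 x.
  apply: tensor_map0r => y; rewrite (cspart SD y) linearD.
  rewrite -[cpart _ _ _]/(cycle_incl D 0 (cyc SD 0 y)) dl0 add0r.
  by rewrite -[spart _ _ _]/(0 : chains D 0) linear0.
apply: (tp_cycle_kill K R_pid Cs Ds SC SD) => // y.
by rewrite -[LHS]/(syzygy_map _ (theta SC a _)) theta_cycle linear0.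
Qed.
End TotalNaturality.

(** * Concatenation of paths *)

Section SeqPaths.
Variables (R : comNzRingType) (V : finType).
Implicit Types (l : seq V) (w : V -> R).

(* 0 unless l has exactly n vertices. *)
Definition seq_path n l : paths R V n :=
  [ffun t : n.-tuple V => (tval t == l)%:R : R^o].

Lemma seq_path_tuple n (t : n.-tuple V) : seq_path n t = path_gen R t.
Proof. by apply/ffunP => s; rewrite !ffunE val_eqE. Qed.

Lemma seq_path_out n l : size l <> n -> seq_path n l = 0.
Proof.
move=> ln; apply/ffunP => s; rewrite !ffunE.
by case: eqP => // sl; case: ln; rewrite -sl size_tuple.
Qed.

Lemma seq_path_gen n l : size l = n -> {t : n.-tuple V | tval t = l}.
Proof. by move=> ln; exists (tcast ln (in_tuple l)); rewrite val_tcast. Qed.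

Definition delete q l := take q l ++ drop q.+1 l.

Lemma size_delete q l : (q < size l)%N -> size (delete q l) = (size l).-1.
Proof.
move=> ql; rewrite size_cat size_drop (size_takel (ltnW ql)).
by case: (size l) ql => // m qm; rewrite subSS subnKC.
Qed.

Lemma tval_face n (t : n.+1.-tuple V) (q : 'I_n.+1) : tval (face t q) = delete q t.
Proof.
have qt : (q < size t)%N by rewrite size_tuple.
apply: (@eq_from_nth _ (tnth t q)) => [|i].
  by rewrite size_delete // !size_tuple.
rewrite size_tuple => it; rewrite -[i]/(nat_of_ord (Ordinal it)) -tnth_nth.
rewrite tnth_mktuple (tnth_nth (tnth t q)) nth_cat size_takel ?(ltnW qt) //=.
rewrite /bump; case: leqP => iq.
  by rewrite nth_drop add1n addSn subnKC.
by rewrite nth_take.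
Qed.

(** The boundary formula on bare sequences, where cutting a concatenation needs no cast between
    tuple lengths. *)
Definition seq_bd w n l : paths R V n :=
  \sum_(q < size l) ((-1) ^+ q * (map w l)`_q) *: seq_path n (delete q l).

(** With the zero map in degree 0, the Leibniz rule for concatenations also covers an empty
    factor. *)
Definition fpbd w n : {linear paths R V n -> paths R V n.-1} :=
  match n return {linear paths R V n -> paths R V n.-1} with
  | 0 => \0
  | m.+1 => full_boundary w m
  end.

Definition rpbd w n : {linear paths R V n -> paths R V n.-1} :=
  match n return {linear paths R V n -> paths R V n.-1} with
  | 0 => \0
  | m.+1 => boundary w m
  end.

Lemma rpbdE w n v : rpbd w n v = regularize (fpbd w n v).
Proof. by case: n v => [|n] v; rewrite /= ?linear0. Qed.

Lemma fpbd_gen w n (t : n.-tuple V) : fpbd w n (path_gen R t) = seq_bd w n.-1 t.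
Proof.
case: n t => [|n] t.
  by rewrite /seq_bd big1 // => -[q]; rewrite size_tuple.
rewrite /= full_boundary_gen /seq_bd; move: (size_tuple t).
move: (size t) => m mn; rewrite {m}mn; apply: eq_bigr => q _.
rewrite -tval_face seq_path_tuple; congr ((_ * _) *: _).
by rewrite (nth_map (tnth t q)) ?size_tuple // -tnth_nth.
Qed.

Lemma seq_bd_cat w n l1 l2 : seq_bd w n (l1 ++ l2)
  = \sum_(q < size l1) ((-1) ^+ q * (map w l1)`_q) *: seq_path n (delete q l1 ++ l2)
    + (-1) ^+ size l1 *: \sum_(q < size l2)
      ((-1) ^+ q * (map w l2)`_q) *: seq_path n (l1 ++ delete q l2).
Proof.
rewrite /seq_bd size_cat big_split_ord /=; congr (_ + _).
  apply: eq_bigr => q _; rewrite map_cat nth_cat size_map ltn_ord.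
  rewrite /delete take_cat ltn_ord drop_cat; case: ltnP => [_|h]; first by rewrite catA.
  rewrite (drop_oversize h) cats0; suff -> : (q.+1 - size l1)%N = 0%N by rewrite drop0.
  by apply/eqP; rewrite subn_eq0.
rewrite scaler_sumr; apply: eq_bigr => q _.
rewrite map_cat nth_cat size_map ltnNge leq_addr /= addKn scalerA mulrA exprD.
congr (_ *: seq_path _ _); rewrite /delete take_cat ltnNge leq_addr /= addKn.
by rewrite drop_cat -addnS ltnNge leq_addr /= addKn catA.
Qed.

Lemma supported_ext n (P : pred (n.-tuple V)) (M : lmodType R)
    (f g : {linear paths R V n -> M}) :
  (forall t, P t -> f (path_gen R t) = g (path_gen R t)) ->
  {in supported_pred P, f =1 g}.
Proof.
move=> fg v /supportedP v0; rewrite (paths_linE f) (paths_linE g).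
apply: eq_bigr => t _; have [/fg -> //|/v0 ->] := boolP (P t).
by rewrite !scale0r.
Qed.

Lemma paths_separated n : separated (paths R V n).
Proof.
have cl (t : n.-tuple V) : linear (fun v : paths R V n => (v t : R^o)).
  by move=> a x y; rewrite !ffunE.
apply: (separated_ffun (ev := fun t => linmap (cl t))) => x hx.
by apply/ffunP => t; rewrite ffunE; apply: hx.
Qed.

Lemma paths_fproj n : fproj (paths R V n).
Proof.
have cl (t : n.-tuple V) : linear (fun v : paths R V n => (v t : R^o)).
  by move=> a x y; rewrite !ffunE.
exists #|{: n.-tuple V}|, (fun i => path_gen R (enum_val i)).
exists (fun i => linmap (cl (enum_val i))) => x.
rewrite [LHS]paths_sum (reindex_onto (@enum_val _ _) (@enum_rank _)) /=; last first.
  by move=> t _; rewrite enum_rankK.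
by apply: eq_bigl => i; rewrite enum_valK eqxx.
Qed.
End SeqPaths.

Lemma tensor_paths_ext (R : comNzRingType) (V V' : finType) a b (M : lmodType R)
    (f g : {linear tensor (paths R V a) (paths R V' b) -> M}) :
  (forall s t, f (tens (path_gen R s) (path_gen R t))
             = g (tens (path_gen R s) (path_gen R t))) -> f =1 g.
Proof.
move=> fg; apply: tensor_ext => u v.
have e t : f \o tens_l _ (path_gen R t) =1 g \o tens_l _ (path_gen R t).
  by apply: paths_ext => s; apply: fg.
have e' : f \o tens_r _ u =1 g \o tens_r _ u.
  by apply: paths_ext => t; apply: e.
exact: e'.
Qed.

Section JoinPaths.
Variables (R : comNzRingType) (V V' : finType).
Local Notation W := (V + V')%type.

Definition seq_join (s : seq V) (t : seq V') : seq W := map inl s ++ map inr t.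

(** The tags [inl] and [inr] show where a concatenation is cut, so partial projections recover both
    pieces. *)
Lemma seq_join_inj s t s' t' : seq_join s t = seq_join s' t' -> s = s' /\ t = t'.
Proof.
pose pl (u : W) := if u is inl x then Some x else None.
pose pr (u : W) := if u is inr x then Some x else None.
have kl s0 t0 : pmap pl (seq_join s0 t0) = s0.
  rewrite pmap_cat map_pK // (_ : pmap pl (map inr t0) = [::]) ?cats0 //.
  by elim: t0.
have kr s0 t0 : pmap pr (seq_join s0 t0) = t0.
  rewrite pmap_cat map_pK // (_ : pmap pr (map inl s0) = [::]) //.
  by elim: s0.
by move=> e; split; [rewrite -[LHS](kl s t) e kl | rewrite -[LHS](kr s t) e kr].
Qed.

Section Maps.
Variables a b n : nat.

Definition path_join_fun (u : paths R V a) (v : paths R V' b) : paths R W n :=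
  path_lift (fun s : a.-tuple V =>
    path_lift (fun t : b.-tuple V' => seq_path R n (seq_join s t)) v) u.

Fact path_join_linear_l v : linear (path_join_fun^~ v).
Proof. by move=> c x y; rewrite /path_join_fun linearP. Qed.

Fact path_join_linear_r u : linear (path_join_fun u).
Proof.
pose F (s : a.-tuple V) :=
  path_lift (fun t : b.-tuple V' => seq_path R n (seq_join s t)).
have E v : path_join_fun u v = \sum_s (u s : R) *: F s v by [].
move=> c x y; rewrite !E scaler_sumr -big_split /=; apply: eq_bigr => s _.
by rewrite linearP scalerDr !scalerA mulrC.
Qed.

Definition path_join :
    {linear tensor (paths R V a) (paths R V' b) -> paths R W n} :=
  tensor_lift path_join_linear_l path_join_linear_r.

Lemma path_join_gen s t :
  path_join (tens (path_gen R s) (path_gen R t)) = seq_path R n (seq_join s t).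
Proof. by rewrite tensor_liftE /path_join_fun !path_liftE. Qed.

(** By [seq_join_inj] at most one term of the double sum is nonzero; none is when the path is not
    [a] vertices of [V] followed by [b] of [V']. *)
Definition path_unjoin :
    {linear paths R W n -> tensor (paths R V a) (paths R V' b)} :=
  path_lift (fun r : n.-tuple W => \sum_(s : a.-tuple V) \sum_(t : b.-tuple V')
    if tval r == seq_join s t then tens (path_gen R s) (path_gen R t) else 0).

Lemma path_unjoin_gen r : path_unjoin (path_gen R r)
  = \sum_(s : a.-tuple V) \sum_(t : b.-tuple V')
      if tval r == seq_join s t then tens (path_gen R s) (path_gen R t) else 0.
Proof. exact: path_liftE. Qed.
End Maps.
Arguments path_join : simpl never.
Arguments path_unjoin : simpl never.

Lemma size_seq_join a b (s : a.-tuple V) (t : b.-tuple V') :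
  size (seq_join s t) = (a + b)%N.
Proof. by rewrite size_cat !size_map !size_tuple. Qed.

Lemma path_join_out a b n z : (a + b)%N <> n -> path_join a b n z = 0.
Proof.
move=> ab; have e : path_join a b n =1 (\0 : {linear _ -> _}).
  apply: tensor_paths_ext => s t.
  by rewrite path_join_gen seq_path_out // size_seq_join.
exact: e.
Qed.

Lemma path_unjoin_out a b n x : (a + b)%N <> n -> path_unjoin a b n x = 0.
Proof.
move=> ab; have e : path_unjoin a b n =1 (\0 : {linear _ -> _}).
  apply: paths_ext => r; rewrite path_unjoin_gen big1 // => s _; rewrite big1 // => t _.
  case: eqP => // e; case: ab.
  by rewrite -(size_seq_join s t) -e size_tuple.
exact: e.
Qed.

Lemma path_joinK a b n z :
  (a + b)%N = n -> path_unjoin a b n (path_join a b n z) = z.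
Proof.
move=> abn; have e : path_unjoin a b n \o path_join a b n =1 lin_id _.
  apply: tensor_paths_ext => s t.
  rewrite -[LHS]/(path_unjoin a b n (path_join a b n _)) path_join_gen.
  have [|r rE] := @seq_path_gen W n (seq_join s t); first by rewrite size_seq_join.
  rewrite -rE seq_path_tuple path_unjoin_gen (big_only1 s) // => [|s' ss _]; last first.
    rewrite big1 // => t' _; rewrite rE.
    by case: eqP => // /seq_join_inj[/val_inj se _]; rewrite se eqxx in ss.
  rewrite (big_only1 t) // => [|t' tt _]; first by rewrite rE eqxx.
  by rewrite rE; case: eqP => // /seq_join_inj[_ /val_inj te]; rewrite te eqxx in tt.
exact: e.
Qed.

Lemma path_join_orth a b a' b' n z :
  a <> a' -> path_unjoin a b n (path_join a' b' n z) = 0.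
Proof.
move=> aa; have e : path_unjoin a b n \o path_join a' b' n =1 (\0 : {linear _ -> _}).
  apply: tensor_paths_ext => s t.
  rewrite -[LHS]/(path_unjoin a b n (path_join a' b' n _)) path_join_gen.
  have [abn|abn] := eqVneq (a' + b')%N n; last first.
    by rewrite seq_path_out ?linear0 // size_seq_join; apply/eqP.
  have [|r rE] := @seq_path_gen W n (seq_join s t); first by rewrite size_seq_join.
  rewrite -rE seq_path_tuple path_unjoin_gen big1 // => s' _; rewrite big1 // => t' _.
  rewrite rE; case: eqP => // /seq_join_inj[se _]; case: aa.
  by rewrite -(size_tuple s) se size_tuple.
exact: e.
Qed.

Lemma path_join_seq_l a b n l (t : b.-tuple V') : size l = a ->
  path_join a b n (tens (seq_path R a l) (path_gen R t)) = seq_path R n (seq_join l t).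
Proof. by case/seq_path_gen => s <-; rewrite seq_path_tuple path_join_gen. Qed.

Lemma path_join_seq_r a b n (s : a.-tuple V) l : size l = b ->
  path_join a b n (tens (path_gen R s) (seq_path R b l)) = seq_path R n (seq_join s l).
Proof. by case/seq_path_gen => t <-; rewrite seq_path_tuple path_join_gen. Qed.

Section Boundary.
Variables (w : V -> R) (w' : V' -> R).
Let wj (u : W) : R := match u with inl x => w x | inr y => w' y end.

Lemma map_delete (T T' : finType) (f : T -> T') q (l : seq T) :
  map f (delete q l) = delete q (map f l).
Proof. by rewrite map_cat map_take map_drop. Qed.

Lemma path_join_full_boundary a b n z :
  full_boundary wj n (path_join a b n.+1 z)
  = path_join a.-1 b n (tensor_map (fpbd w a) (lin_id _) z)
    + (-1) ^+ a *: path_join a b.-1 n (tensor_map (lin_id _) (fpbd w' b) z).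
Proof.
(* In the wrong total degree a truncated predecessor may still land in degree n, as for a = 0 and b
   = n; such terms vanish because [fpbd] is zero in degree 0. *)
have [abn|abn] := eqVneq (a + b)%N n.+1; last first.
  rewrite [in LHS]path_join_out ?linear0; last exact/eqP.
  case: a b z abn => [|a] b z abn.
    rewrite tensor_map0l // linear0 add0r.
    case: b z abn => [|b] z abn; first by rewrite tensor_map0r // linear0 scaler0.
    rewrite path_join_out ?scaler0 //.
    by move/eqP: abn; rewrite !add0n /= => h /(congr1 S).
  rewrite path_join_out; last by move/eqP: abn; rewrite addSn => h /(congr1 S).
  case: b z abn => [|b] z abn; first by rewrite tensor_map0r // linear0 scaler0 addr0.
  rewrite path_join_out ?scaler0 ?addr0 //=.
  by move/eqP: abn; rewrite addnS => h /(congr1 S).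
pose f := tensor_map (fpbd w a) (lin_id (paths R V' b)).
pose g := tensor_map (lin_id (paths R V a)) (fpbd w' b).
have e : full_boundary wj n \o path_join a b n.+1 =1
    (path_join a.-1 b n \o f) \+ ((-1) ^+ a \*: (path_join a b.-1 n \o g)).
  apply: tensor_paths_ext => s t.
  rewrite -[LHS]/(full_boundary wj n (path_join _ _ _ _)) path_join_gen.
  rewrite -[RHS]/(path_join a.-1 b n (f _) + (-1) ^+ a *: path_join a b.-1 n (g _)).
  have [|r rE] := @seq_path_gen W n.+1 (seq_join s t); first by rewrite size_seq_join.
  rewrite -rE seq_path_tuple -[LHS]/(fpbd wj n.+1 (path_gen R r)) fpbd_gen rE.
  rewrite /seq_join seq_bd_cat !size_map size_tuple !tensor_mapE !fpbd_gen.
  congr (_ + _ *: _).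
    rewrite /seq_bd -[tens _ _]/(tens_l _ (path_gen R t) _) linear_sum.
    rewrite linear_sum size_tuple; apply: eq_bigr => q _.
    have qs : (q < size s)%N by rewrite size_tuple.
    rewrite linearZ_LR linearZ_LR -[tens_l _ _ _]/(tens _ _) path_join_seq_l; last first.
      by rewrite size_delete ?size_tuple.
    by rewrite -map_delete -map_comp.
  rewrite /seq_bd -[tens _ _]/(tens_r _ (path_gen R s) _) linear_sum.
  rewrite linear_sum size_tuple; apply: eq_bigr => q _.
  have qs : (q < size t)%N by rewrite size_tuple.
  rewrite linearZ_LR linearZ_LR -[tens_r _ _ _]/(tens _ _) path_join_seq_r; last first.
    by rewrite size_delete ?size_tuple.
  by rewrite -map_delete -map_comp.
exact: e.
Qed.

(** The two vertices at the junction are always distinct, so a concatenation is regular exactly when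
    both pieces are. *)
Lemma path_join_regularize a b n z : regularize (path_join a b n z)
  = path_join a b n (tensor_map regularize regularize z).
Proof.
have e : regularize \o path_join a b n
    =1 path_join a b n \o tensor_map regularize regularize.
  apply: tensor_paths_ext => s t.
  rewrite -[LHS]/(regularize (path_join _ _ _ _)) path_join_gen.
  rewrite -[RHS]/(path_join a b n (tensor_map _ _ _)) tensor_mapE !regularize_gen.
  have -> : regularize (seq_path R n (seq_join s t)) =
      if sorted (fun x y => x != y) (seq_join s t)
      then seq_path R n (seq_join s t) else 0.
    apply/ffunP => r; rewrite regularizeE /regular.
    have [rE|rE] := eqVneq (tval r) (seq_join s t).
      by rewrite rE; case: ifP; rewrite // ffunE.
    by do 2! case: ifP => _; rewrite !ffunE // (negPf rE).
  have -> : sorted (fun x y => x != y) (seq_join s t) = regular s && regular t.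
    rewrite /regular /seq_join; case: (tval s) => [|x l] /=; first by rewrite sorted_map.
    rewrite cat_path !path_map; congr (_ && _).
    case: (tval t) => [|y l'] //=; rewrite path_map.
    have -> : last (inl x) (map inl l) != inr y :> W by rewrite last_map.
    by [].
  case: (regular s); last by rewrite tens0l linear0.
  by case: (regular t); [rewrite path_join_gen | rewrite tens0r linear0].
exact: e.
Qed.

(** Regularizing a concatenation acts on both factors, hence [regularize] where an identity would be
    expected. *)
Lemma path_join_boundary a b n z :
  boundary wj n (path_join a b n.+1 z)
  = path_join a.-1 b n (tensor_map (rpbd w a) regularize z)
    + (-1) ^+ a *: path_join a b.-1 n (tensor_map regularize (rpbd w' b) z).
Proof.
rewrite -[LHS]/(regularize (full_boundary wj n _)) path_join_full_boundary.
rewrite linearD linearZ_LR !path_join_regularize !tensor_map_comp.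
congr (_ + _ *: _).
  by congr (path_join a.-1 b n _); apply: eq_tensor_map => v; rewrite ?rpbdE.
by congr (path_join a b.-1 n _); apply: eq_tensor_map => v; rewrite ?rpbdE.
Qed.

Lemma path_join_sum a b n z : let x := path_join a b n z in (a + b)%N = n ->
  x = \sum_(i < n.+1) path_join i (n - i) n (path_unjoin i (n - i) n x).
Proof.
move=> x abn; have an : (a < n.+1)%N by rewrite -abn ltnS leq_addr.
rewrite (big_only1 (Ordinal an)) // => [|i ia _]; last first.
  rewrite path_join_orth ?linear0 // => ai; case/eqP: ia; apply: val_inj.
  exact: ai.
rewrite -[nat_of_ord _]/a; have -> : (n - a)%N = b by rewrite -abn addKn.
by rewrite path_joinK.
Qed.

Lemma path_unjoin_boundary n a b x :
  x = \sum_(i < n.+2)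
        path_join i (n.+1 - i) n.+1 (path_unjoin i (n.+1 - i) n.+1 x) ->
  path_unjoin a b n (boundary wj n x)
  = tensor_map (boundary w a) regularize (path_unjoin a.+1 b n.+1 x)
    + (-1) ^+ a *: tensor_map regularize (boundary w' b) (path_unjoin a b.+1 n.+1 x).
Proof.
move=> xE; apply: (@bigraded_proj_bd R (fun a b => tensor (paths R V a) (paths R V' b))
  (paths R W) (fun a b => tensor_map (rpbd w a) regularize)
  (fun a b => tensor_map regularize (rpbd w' b)) path_join path_unjoin
  (boundary wj)) => //.
- by move=> *; apply: tensor_map0l.
- by move=> *; apply: tensor_map0r.
- exact: path_joinK.
- exact: path_join_orth.
- exact: path_unjoin_out.
- exact: path_join_boundary.
Qed.
End Boundary.
End JoinPaths.
Arguments path_join {R V V'} a b n.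
Arguments path_unjoin {R V V'} a b n.

Lemma push_path_join (R : comNzRingType) (V V' U U' : finType)
    (f : V -> U) (f' : V' -> U') (h : V + V' -> U + U') a b n z :
  (forall x, h (inl x) = inl (f x)) -> (forall y, h (inr y) = inr (f' y)) ->
  push R h n (path_join a b n z)
  = path_join a b n (tensor_map (push R f a) (push R f' b) z).
Proof.
move=> hl hr.
have e : full_push R h n \o path_join a b n
    =1 path_join a b n \o tensor_map (full_push R f a) (full_push R f' b).
  apply: tensor_paths_ext => s t.
  rewrite -[LHS]/(full_push R h n (path_join _ _ _ _)) path_join_gen.
  rewrite -[RHS]/(path_join a b n (tensor_map _ _ _)) tensor_mapE !full_push_gen.
  rewrite path_join_gen; have [abn|abn] := eqVneq (a + b)%N n; last first.
    by rewrite !seq_path_out ?linear0 // size_seq_join; apply/eqP.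
  have [|r rE] := @seq_path_gen _ n (seq_join s t); first by rewrite size_seq_join.
  rewrite -rE seq_path_tuple full_push_gen -seq_path_tuple /= rE.
  rewrite /seq_join map_cat -!map_comp.
  by rewrite (eq_map (g := inl \o f)) // (@eq_map _ _ (h \o inr) (inr \o f')).
rewrite -[LHS]/(regularize (full_push R h n _)) -[full_push _ _ _ _]/((_ \o _) z) e.
by rewrite path_join_regularize tensor_map_comp.
Qed.

Arguments allowed_pred {R} G n.
Arguments Omega_pred {R} G n.

(** * The complex of a join *)

Section Omega.
Variables (R : comNzRingType) (G : wdigraph R).
Local Notation P := (paths R (vertex G)).

Definition allowed_part n : {linear P n -> P n} :=
  path_lift (fun t => if allowed t then path_gen R t else 0).

(** Its vanishing expresses allowedness as a linear equation, the form to which flatness applies. *)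
Definition forbidden_part n : {linear P n -> P n} :=
  path_lift (fun t => if allowed t then 0 else path_gen R t).

Lemma allowed_part_gen n t : allowed_part n (path_gen R t) = if allowed t then path_gen R t else 0.
Proof. exact: path_liftE. Qed.

Lemma forbidden_part_gen n t : forbidden_part n (path_gen R t) = if allowed t then 0 else path_gen R t.
Proof. exact: path_liftE. Qed.

Lemma allowed_partE n v : allowed_part n v = v - forbidden_part n v.
Proof.
have e : allowed_part n =1 lin_id _ \- forbidden_part n.
  apply: paths_ext => t; rewrite allowed_part_gen -[RHS]/(path_gen R t - forbidden_part n _) forbidden_part_gen.
  by case: ifP; rewrite ?subr0 ?subrr.
exact: e.
Qed.

Lemma allowedE n v : (v \in allowed_pred G n) = (forbidden_part n v == 0).
Proof.
apply/idP/eqP => [|v0].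
  have : {in allowed_pred G n, forbidden_part n =1 (\0 : {linear P n -> P n})}.
    by apply: supported_ext => t at_; rewrite forbidden_part_gen at_.
  by apply.
rewrite -[v]subr0 -v0 -allowed_partE [allowed_part n v]paths_linE.
apply: rpred_sum => t _; rewrite rpredZ // allowed_part_gen.
by case: ifP => [at_|_]; [apply: path_gen_supported | apply: rpred0].
Qed.

Lemma allowed_part_id n v : v \in allowed_pred G n -> allowed_part n v = v.
Proof. by rewrite allowedE allowed_partE => /eqP ->; rewrite subr0. Qed.

Lemma regularize_allowed n v : v \in allowed_pred G n -> regularize v = v.
Proof.
have : {in allowed_pred G n, regularize =1 lin_id (P n)}.
  by apply: supported_ext => t /allowed_regular rt; rewrite regularize_gen rt.
by apply.
Qed.

Lemma forbidden_part_regularize n v : forbidden_part n (regularize v) = regularize (forbidden_part n v).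
Proof.
have e : forbidden_part n \o regularize =1 regularize \o forbidden_part n.
  apply: paths_ext => t; rewrite -[LHS]/(forbidden_part n (regularize _)).
  rewrite -[RHS]/(regularize (forbidden_part n _)) regularize_gen forbidden_part_gen.
  case: ifP => rt; case: ifP => at_;
    by rewrite ?linear0 ?forbidden_part_gen ?at_ ?regularize_gen ?rt.
exact: e.
Qed.

Local Notation bdG := (rpbd (@weight R G)).

Lemma Omega_predE n v : (v \in Omega_pred G n) =
  (v \in allowed_pred G n) && (bdG n v \in allowed_pred G n.-1).
Proof.
case: n v => [|n] v //.
by rewrite (_ : bdG 0 v \in _) ?andbT //; apply: rpred0.
Qed.

Definition Omega_incl n : {linear Omega G n -> P n} := submod_incl _.

Lemma Omega_allowed n (u : Omega G n) : Omega_incl n u \in allowed_pred G n.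
Proof. by have := valP u; rewrite Omega_predE => /andP[]. Qed.

Lemma Omega_bd_allowed n (u : Omega G n) :
  bdG n (Omega_incl n u) \in allowed_pred G n.-1.
Proof. by have := valP u; rewrite Omega_predE => /andP[]. Qed.

Lemma Omega_pbd n (u : Omega G n) :
  bdG n (Omega_incl n u) = Omega_incl n.-1 (pbd (path_complex G) n u).
Proof. by case: n u. Qed.

Lemma Omega_separated n : separated (Omega G n).
Proof.
apply: (separated_inj (j := Omega_incl n)); last exact: paths_separated.
by move=> u u0; apply: val_inj.
Qed.

Definition Omega_retraction n (p : {linear P n -> Omega G n}) : Prop :=
  forall u, p (Omega_incl n u) = u.

(* Omega is cut out inside the free module of all paths by linear equations
   with values in free modules; hence flatness lets one recognize Omega (x) P
   inside paths (x) P. *)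
Section Retraction.
Variables (n : nat) (p : {linear P n -> Omega G n}).
Hypothesis pK : Omega_retraction p.
Variables (M : lmodType R) (Mp : fproj M).

Let Omega_defect (v : P n) : forbidden_part n v = 0 -> forbidden_part n.-1 (bdG n v) = 0 ->
  (lin_id _ \- (Omega_incl n \o p)) v = 0.
Proof.
move=> /eqP v1 /eqP v2; have vO : v \in Omega_pred G n.
  by rewrite Omega_predE !allowedE v1 v2.
rewrite -[LHS]/(Omega_incl n (Submod vO) - Omega_incl n (p (Omega_incl n (Submod vO)))).
by rewrite pK subrr.
Qed.

Lemma Omega_tensor_l (z : tensor (P n) M) :
  tensor_map (forbidden_part n) (lin_id _) z = 0 ->
  tensor_map (forbidden_part n.-1 \o bdG n) (lin_id _) z = 0 ->
  tensor_map (Omega_incl n \o p) (lin_id _) z = z.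
Proof.
move=> z1 z2.
rewrite -[RHS](tensor_map_id (f := lin_id _) (g := lin_id _)) //.
rewrite [RHS](@tensor_mapDl _ _ _ _ _ _ (Omega_incl n \o p)
  (lin_id _ \- (Omega_incl n \o p))); last first.
  by move=> v; rewrite -[RHS]/(_ + (v - _)) addrC subrK.
by rewrite [X in _ + X](fproj_flat2_l Mp
  (f1 := forbidden_part n) (f2 := forbidden_part n.-1 \o bdG n) Omega_defect) ?addr0.
Qed.

Lemma Omega_tensor_r (z : tensor M (P n)) :
  tensor_map (lin_id _) (forbidden_part n) z = 0 ->
  tensor_map (lin_id _) (forbidden_part n.-1 \o bdG n) z = 0 ->
  tensor_map (lin_id _) (Omega_incl n \o p) z = z.
Proof.
move=> z1 z2; apply: (can_inj (@tensor_swapK _ _ _)).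
by rewrite tensor_swap_map Omega_tensor_l // -tensor_swap_map ?z1 ?z2 linear0.
Qed.
End Retraction.
End Omega.
Arguments forbidden_part {R} G n.
Arguments allowed_part {R} G n.
Arguments Omega_incl {R} G n.
Arguments allowed_part : simpl never.
Arguments forbidden_part : simpl never.

(** The two conditions defining Omega combine into one linear map to a product of path modules,
    which is separated. *)
Lemma Omega_retraction_exists (R : idomainType) (G : wdigraph R) n :
  principal_ideal_domain R -> exists p, @Omega_retraction R G n p.
Proof.
move=> R_pid; pose f v := (forbidden_part G n v, forbidden_part G n.-1 (rpbd (@weight R G) n v)).
have fl : linear f by move=> a x y; rewrite /f !linearP.
have [F FE] := linmapP fl.
apply: (ker_retraction R_pid (f := F)) => [|v].
  exact/separated_prod/paths_separated/paths_separated.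
by rewrite FE -pair_eqE /= -!allowedE -Omega_predE.
Qed.

(** * Omega of a join as a total complex *)

Section OmegaJoin.
Variables (R : comNzRingType) (G G' : wdigraph R).
Local Notation J := (join G G').
Local Notation P := (paths R (vertex G)).
Local Notation P' := (paths R (vertex G')).

(** All edges from [G] to [G'] are present, so the junction imposes no condition. *)
Lemma sorted_join (s : seq (vertex G)) (t : seq (vertex G')) :
  sorted (@edge R J) (seq_join s t) = sorted (@edge R G) s && sorted (@edge R G') t.
Proof.
rewrite /seq_join; case: s => [|x s] /=; first by rewrite sorted_map.
rewrite cat_path path_map; congr (_ && _); case: t => [|y t] //=.
by rewrite path_map last_map.
Qed.

(** No edge leads from [G'] back to [G]: an allowed path that has entered [G'] stays there. *)
Lemma allowed_seq_join (r : seq (vertex J)) : sorted (@edge R J) r ->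
  exists s t, r = seq_join s t.
Proof.
elim: r => [|u r IH] ur; first by exists [::], [::].
have [s [t rE]] := IH (path_sorted ur); case: u ur => [x|y] ur.
  by exists (x :: s), t; rewrite rE.
exists [::], (y :: t); case: s rE => [|x s] rE; first by rewrite rE.
by move: ur; rewrite rE.
Qed.

Lemma allowed_join_sum n x : x \in allowed_pred J n ->
  x = \sum_(i < n.+1) path_join i (n - i) n (path_unjoin i (n - i) n x).
Proof.
pose h x : paths R (vertex J) n :=
  \sum_(i < n.+1) path_join i (n - i) n (path_unjoin i (n - i) n x).
have hl : linear h.
  move=> a u v; rewrite /h scaler_sumr -big_split; apply: eq_bigr => i _.
  by rewrite (linearP (path_unjoin _ _ _)) (linearP (path_join _ _ _)).
have [H HE] := linmapP hl.
have : {in allowed_pred J n, lin_id _ =1 H}.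
  apply: supported_ext => r ar; rewrite HE.
  have [s [t rE]] := allowed_seq_join ar.
  have stn : (size s + size t)%N = n.
    by rewrite -(size_tuple r) rE size_cat !size_map.
  have -> : path_gen R r = path_join (size s) (size t) n
      (tens (path_gen R (in_tuple s)) (path_gen R (in_tuple t))).
    by rewrite path_join_gen -seq_path_tuple rE.
  exact: (path_join_sum (tens _ _) stn).
by move=> e xa; have := e x xa; rewrite HE.
Qed.

Lemma path_join_allowed a b n u v : u \in allowed_pred G a ->
  v \in allowed_pred G' b -> path_join a b n (tens u v) \in allowed_pred J n.
Proof.
move=> /allowed_part_id <- /allowed_part_id <-; rewrite (@allowedE R J) -tensor_mapE; apply/eqP.
have e : (forbidden_part J n \o path_join a b n) \o tensor_map (allowed_part G a) (allowed_part G' b)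
    =1 (\0 : {linear _ -> _}).
  apply: tensor_paths_ext => s t.
  rewrite -[LHS]/(forbidden_part J n (path_join a b n (tensor_map _ _ (tens _ _)))).
  rewrite tensor_mapE !allowed_part_gen.
  case: ifP => sa; last by rewrite tens0l !linear0.
  case: ifP => ta; last by rewrite tens0r !linear0.
  rewrite path_join_gen; have [abn|abn] := eqVneq (a + b)%N n; last first.
    by rewrite seq_path_out ?linear0 // size_seq_join; apply/eqP.
  have [|r rE] := @seq_path_gen _ n (seq_join s t); first by rewrite size_seq_join.
  rewrite -rE seq_path_tuple forbidden_part_gen /allowed rE sorted_join.
  by rewrite -/(allowed s) sa -/(allowed t) ta.
exact: e.
Qed.

Lemma forbidden_part_unjoin a b n x : x \in allowed_pred J n ->
  tensor_map (forbidden_part G a) (lin_id _) (path_unjoin a b n x) = 0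
  /\ tensor_map (lin_id _) (forbidden_part G' b) (path_unjoin a b n x) = 0.
Proof.
have zero (r : n.-tuple (vertex J)) (M : lmodType R)
    (f : {linear tensor (P a) (P' b) -> M}) : allowed r ->
  (forall s t, allowed s -> allowed t -> f (tens (path_gen R s) (path_gen R t)) = 0) ->
  f (path_unjoin a b n (path_gen R r)) = 0.
  move=> ar f0; rewrite path_unjoin_gen linear_sum big1 // => s _.
  rewrite linear_sum big1 // => t _; case: eqP => [rE|_]; last exact: linear0.
  by move: ar; rewrite /allowed rE sorted_join => /andP[]; apply: f0.
move=> xa; split.
  have : {in allowed_pred J n,
      tensor_map (forbidden_part G a) (lin_id _) \o path_unjoin a b n =1 (\0 : {linear _ -> _})}.
    apply: supported_ext => r ar; apply: (zero r) => // s t sa _.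
    by rewrite tensor_mapE forbidden_part_gen sa tens0l.
  by apply.
have : {in allowed_pred J n,
    tensor_map (lin_id _) (forbidden_part G' b) \o path_unjoin a b n =1 (\0 : {linear _ -> _})}.
  apply: supported_ext => r ar; apply: (zero r) => // s t _ ta.
  by rewrite tensor_mapE forbidden_part_gen ta tens0r.
by apply.
Qed.

Lemma regularize_path_unjoin a b n x : x \in allowed_pred J n ->
  tensor_map regularize (lin_id _) (path_unjoin a b n x) = path_unjoin a b n x
  /\ tensor_map (lin_id _) regularize (path_unjoin a b n x) = path_unjoin a b n x.
Proof.
move=> /(forbidden_part_unjoin a b)[x1 x2].
have reg0 (H : wdigraph R) m (v : paths R (vertex H) m) :
    forbidden_part H m v = 0 -> (lin_id _ \- regularize) v = 0.
  move=> /eqP; rewrite -allowedE => va.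
  by rewrite -[LHS]/(v - regularize v) regularize_allowed // subrr.
split; apply/eqP; rewrite eq_sym -subr_eq0; apply/eqP; set y := path_unjoin _ _ _ _.
  rewrite -[X in X - _](tensor_map_id (f := lin_id _) (g := lin_id _)) //.
  rewrite (@tensor_mapDl _ _ _ _ _ _ regularize (lin_id _ \- regularize)); last first.
    by move=> v; rewrite -[RHS]/(_ + (v - _)) addrC subrK.
  rewrite addrC addKr.
  exact: (fproj_flat_l (paths_fproj _ _ _) (reg0 _ _)) x1.
rewrite -[X in X - _](tensor_map_id (f := lin_id _) (g := lin_id _)) //.
rewrite (@tensor_mapDr _ _ _ _ _ _ _ regularize (lin_id _ \- regularize)); last first.
  by move=> v; rewrite -[RHS]/(_ + (v - _)) addrC subrK.
rewrite addrC addKr.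
exact: (fproj_flat (paths_fproj _ _ _) (reg0 _ _)) x2.
Qed.

(* The component of the boundary of x in bidegree (i, j) is the sum of a term in
   R_i (x) A_j, where a vertex of G was deleted, and a term in A_i (x) R_j. As the
   sum is in A_i (x) A_j, so is each of the two terms. *)
Lemma forbidden_part_bd_unjoin a b n x : x \in Omega_pred J n ->
  tensor_map (forbidden_part G a.-1 \o rpbd (@weight R G) a) (lin_id _)
    (path_unjoin a b n x) = 0
  /\ tensor_map (lin_id _) (forbidden_part G' b.-1 \o rpbd (@weight R G') b)
    (path_unjoin a b n x) = 0.
Proof.
rewrite (@Omega_predE R J) => /andP[xa bxa].
(* The Leibniz formula solved for the term that deletes a vertex of [G]. The other two terms are
   allowed in the left factor. *)
have key i j m (y : paths R (vertex J) m.+1) : y \in allowed_pred J m.+1 ->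
    boundary (@weight R J) m y \in allowed_pred J m ->
    tensor_map (boundary (@weight R G) i) regularize (path_unjoin i.+1 j m.+1 y)
    = - ((-1) ^+ i *: tensor_map regularize (boundary (@weight R G') j)
          (path_unjoin i j.+1 m.+1 y))
      + path_unjoin i j m (boundary (@weight R J) m y).
  move=> ya bya; rewrite (@path_unjoin_boundary R _ _ (@weight R G) (@weight R G')).
    by rewrite addrC addrK.
  exact: allowed_join_sum.
split.
  case: a => [|a]; first by apply: tensor_map0l => v; rewrite /= linear0.
  case: n => [|n] in x xa bxa *; first by rewrite path_unjoin_out ?linear0.
  (* Regularizing the right factor changes nothing here and produces the left-hand side of [key]. *)
  rewrite -[path_unjoin _ _ _ _](regularize_path_unjoin _ _ xa).2 tensor_map_comp.
  rewrite (@eq_tensor_map _ _ _ _ _ _ (forbidden_part G a \o boundary (@weight R G) a) _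
    (lin_id _ \o regularize)) // -tensor_map_comp key // linearD linearN linearZ_LR.
  rewrite (forbidden_part_unjoin _ _ bxa).1 addr0 tensor_map_comp.
  rewrite (@eq_tensor_map _ _ _ _ _ _ (regularize \o forbidden_part G a) _
    (boundary (@weight R G') b \o lin_id _)) //; last exact: forbidden_part_regularize.
  by rewrite -tensor_map_comp (forbidden_part_unjoin _ _ xa).1 linear0 scaler0 oppr0.
case: b => [|b]; first by apply: tensor_map0r => v; rewrite /= linear0.
case: n => [|n] in x xa bxa *; first by rewrite path_unjoin_out ?linear0 // addnS.
rewrite -[path_unjoin _ _ _ _](regularize_path_unjoin _ _ xa).1 tensor_map_comp.
rewrite (@eq_tensor_map _ _ _ _ _ _ (lin_id _ \o regularize) _
  (forbidden_part G' b \o boundary (@weight R G') b)) // -tensor_map_comp.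
have -> : tensor_map regularize (boundary (@weight R G') b) (path_unjoin a b.+1 n.+1 x)
    = (-1) ^+ a *: (path_unjoin a b n (boundary (@weight R J) n x)
        - tensor_map (boundary (@weight R G) a) regularize (path_unjoin a.+1 b n.+1 x)).
  rewrite (key a b n x xa bxa) opprD opprK addrCA subrr addr0.
  by rewrite scalerA -expr2 sqrr_sign scale1r.
rewrite linearZ_LR linearB (forbidden_part_unjoin _ _ bxa).2 sub0r tensor_map_comp.
rewrite (@eq_tensor_map _ _ _ _ _ _ (boundary (@weight R G) a \o lin_id _) _
  (regularize \o forbidden_part G' b)) //; last exact: forbidden_part_regularize.
by rewrite -tensor_map_comp (forbidden_part_unjoin _ _ xa).2 linear0 oppr0 scaler0.
Qed.

Section Maps.
Variables a b n : nat.

Definition Omega_join_path :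
    {linear tensor (Omega G a) (Omega G' b) -> paths R (vertex J) n} :=
  path_join a b n \o tensor_map (Omega_incl G a) (Omega_incl G' b).

Fact Omega_join_subproof z : Omega_join_path z \in Omega_pred J n.
Proof.
apply: (@tensor_range R _ _ _ _ Omega_join_path z) => u v.
rewrite -[Omega_join_path _]/(path_join a b n (tensor_map _ _ _)).
rewrite tensor_mapE (@Omega_predE R J).
rewrite path_join_allowed ?Omega_allowed //=; case: n => [|m]; first exact: rpred0.
rewrite -[rpbd _ _ _]/(boundary (@weight R J) m _).
rewrite (@path_join_boundary R _ _ (@weight R G) (@weight R G')) !tensor_mapE.
rewrite !(regularize_allowed (Omega_allowed _)).
by rewrite rpredD ?rpredZ ?path_join_allowed ?Omega_allowed ?Omega_bd_allowed.
Qed.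

Definition Omega_join : {linear tensor (Omega G a) (Omega G' b) -> Omega J n} :=
  corestrict Omega_join_subproof.

Lemma Omega_joinE z : Omega_incl J n (Omega_join z)
  = path_join a b n (tensor_map (Omega_incl G a) (Omega_incl G' b) z).
Proof. by []. Qed.
End Maps.
Arguments Omega_join : simpl never.

Lemma Omega_incl_inj (H : wdigraph R) n : injective (Omega_incl H n).
Proof. exact: val_inj. Qed.

Section TotData.
Variables (p : forall n, {linear P n -> Omega G n})
          (p' : forall n, {linear P' n -> Omega G' n}).
Hypotheses (pK : forall n, Omega_retraction (p n))
           (pK' : forall n, Omega_retraction (p' n)).

Definition Omega_unjoin a b n :
    {linear Omega J n -> tensor (Omega G a) (Omega G' b)} :=
  (tensor_map (p a) (p' b) \o path_unjoin a b n) \o Omega_incl J n.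

(** The retractions lose nothing on the components of a chain of the join. Retracting one factor at
    a time keeps the other a full path module, which is flat. *)
Lemma Omega_unjoin_incl a b n x :
  tensor_map (Omega_incl G a) (Omega_incl G' b) (Omega_unjoin a b n x)
  = path_unjoin a b n (Omega_incl J n x).
Proof.
rewrite -[Omega_unjoin _ _ _ _]/(tensor_map (p a) (p' b) (path_unjoin a b n _)).
set y := path_unjoin a b n _; rewrite tensor_map_comp.
have [y1 y2] := forbidden_part_unjoin a b (Omega_allowed x).
have [y3 y4] := forbidden_part_bd_unjoin a b (valP x).
rewrite (@eq_tensor_map _ _ _ _ _ _ ((Omega_incl G a \o p a) \o lin_id _) _
  (lin_id _ \o (Omega_incl G' b \o p' b))) // -tensor_map_comp.
rewrite (Omega_tensor_r (@pK' b) (paths_fproj _ _ _)) //.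
by rewrite (Omega_tensor_l (@pK a) (paths_fproj _ _ _)).
Qed.

(** The inclusions are pinned to the choice-free [Omega_join], as naturality requires; the
    retractions enter the projections only. *)
Lemma Omega_tot_data : inhabited
  {K : tot_data (path_complex G) (path_complex G') (path_complex J) |
    tm K = Omega_join}.
Proof.
split.
unshelve refine (exist _ (@TotData R (path_complex G) (path_complex G')
  (path_complex J) Omega_join Omega_unjoin _ _ _ _ _ _) erefl).
- move=> a b n z abn.
  rewrite -[LHS]/(tensor_map (p a) (p' b) (path_unjoin a b n
    (path_join a b n (tensor_map (Omega_incl G a) (Omega_incl G' b) z)))).
  rewrite path_joinK // tensor_map_comp tensor_map_id // => u.
    exact: pK.
  exact: pK'.
- move=> a b a' b' n z aa.
  rewrite -[LHS]/(tensor_map (p a) (p' b) (path_unjoin a b n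
    (path_join a' b' n (tensor_map (Omega_incl G a') (Omega_incl G' b') z)))).
  by rewrite path_join_orth ?linear0.
- move=> a b n z abn; apply: val_inj.
  rewrite -[LHS]/(path_join a b n (tensor_map (Omega_incl G a) (Omega_incl G' b) z)).
  by rewrite path_join_out.
- move=> a b n x abn.
  rewrite -[LHS]/(tensor_map (p a) (p' b) (path_unjoin a b n (Omega_incl J n x))).
  by rewrite path_unjoin_out ?linear0.
- move=> n x; apply: Omega_incl_inj; rewrite linear_sum.
  rewrite [LHS](allowed_join_sum (Omega_allowed x)); apply: eq_bigr => i _.
  by rewrite Omega_joinE Omega_unjoin_incl.
- move=> a b n z; apply: Omega_incl_inj; rewrite linearD linearZ_LR !Omega_joinE.
  rewrite -[LHS]/(boundary (@weight R J) n (path_join a b n.+1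
    (tensor_map (Omega_incl G a) (Omega_incl G' b) z))).
  rewrite (@path_join_boundary R _ _ (@weight R G) (@weight R G')) !tensor_map_comp.
  congr (_ + _ *: _).
    congr (path_join a.-1 b n _); apply: eq_tensor_map => u.
      exact: Omega_pbd.
    exact: regularize_allowed (Omega_allowed u).
  congr (path_join a b.-1 n _); apply: eq_tensor_map => u.
    exact: regularize_allowed (Omega_allowed u).
  exact: Omega_pbd.
Qed.
End TotData.
End OmegaJoin.
Arguments Omega_join {R} G G' a b n.

Lemma Omega_join_nat (R : comNzRingType) (G1 G2 G1' G2' : wdigraph R)
    (f : wdigraph_map G1 G2) (f' : wdigraph_map G1' G2') a b n z :
  Omega_map (join_map f f') n (Omega_join G1 G1' a b n z)
  = Omega_join G2 G2' a b n (tensor_map (Omega_map f a) (Omega_map f' b) z).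
Proof.
apply: Omega_incl_inj; rewrite Omega_joinE.
rewrite -[LHS]/(push R (join_map f f') n (path_join a b n
  (tensor_map (Omega_incl G1 a) (Omega_incl G1' b) z))).
rewrite (@push_path_join R _ _ _ _ f f') // !tensor_map_comp.
by congr (path_join a b n _); apply: eq_tensor_map.
Qed.

(** * The sums over all degrees *)

Section TorFunctor.
Variable R : comNzRingType.

Lemma Tor_map_comp_id (M N M' N' : lmodType R) (f : {linear M -> M'})
    (g : {linear N -> N'}) (f' : {linear M' -> M}) (g' : {linear N' -> N}) t :
  (forall x, f' (f x) = x) -> (forall x, g' (g x) = x) ->
  Tor_map f' g' (Tor_map f g t) = t.
Proof.
move=> ff gg; apply: val_inj.
rewrite -[LHS]/(tensor_map (syzygy_map f') g' (tensor_map (syzygy_map f) g (val t))).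
rewrite tensor_map_comp tensor_map_id // => s; apply: val_inj.
have e : free_map R f' \o free_map R f =1 lin_id _.
  apply: free_ext => k; rewrite -[LHS]/(free_map R f' (free_map R f _)).
  by rewrite !free_mapE ff.
exact: e.
Qed.

Lemma Tor_map_square (M N M1 N1 M2 N2 M3 N3 : lmodType R)
    (f1 : {linear M1 -> M3}) (g1 : {linear N1 -> N3})
    (f2 : {linear M -> M1}) (g2 : {linear N -> N1})
    (f1' : {linear M2 -> M3}) (g1' : {linear N2 -> N3})
    (f2' : {linear M -> M2}) (g2' : {linear N -> N2}) t :
  f1 \o f2 =1 f1' \o f2' -> g1 \o g2 =1 g1' \o g2' ->
  Tor_map f1 g1 (Tor_map f2 g2 t) = Tor_map f1' g1' (Tor_map f2' g2' t).
Proof.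
move=> ff gg; apply: val_inj.
rewrite -[LHS]/(tensor_map (syzygy_map f1) g1 (tensor_map (syzygy_map f2) g2 (val t))).
rewrite -[RHS]/(tensor_map (syzygy_map f1') g1'
  (tensor_map (syzygy_map f2') g2' (val t))).
apply: tensor_map_square => // s; apply: val_inj.
have e : free_map R f1 \o free_map R f2 =1 free_map R f1' \o free_map R f2'.
  apply: free_ext => k; rewrite -[LHS]/(free_map R f1 (free_map R f2 _)).
  rewrite -[RHS]/(free_map R f1' (free_map R f2' _)) !free_mapE.
  by rewrite -[f1 _]/((f1 \o f2) k) ff.
exact: e.
Qed.

Lemma Tor_trivial (M N : lmodType R) (t : Tor M N) : (forall y : N, y = 0) -> t = 0.
Proof.
move=> N0; apply: val_inj.
rewrite -[LHS](tensor_map_id (f := lin_id _) (g := lin_id N)) //.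
exact: tensor_map0r.
Qed.
End TorFunctor.

Section Degrees.
Variable R : comNzRingType.
Implicit Types G : wdigraph R.

(* Truncated for p < -1: there path_homology G p is 0, but the homology in degree
   nverts p = 0 need not be, and hom_to and hom_from are the zero maps. *)
Definition nverts (p : int) : nat := if p is Posz n then n.+1 else 0.

Lemma nverts_sub1 (i : nat) : nverts (i%:Z - 1) = i.
Proof. by case: i => // i; rewrite -addn1 PoszD addrK addn1. Qed.

Lemma nverts_sub (r i : nat) : (i <= r.+1)%N -> nverts (r%:Z - i%:Z) = (r.+1 - i)%N.
Proof.
move=> ir; rewrite -[in RHS](nverts_sub1 (r.+1 - i)) -subzn //; congr nverts.
by rewrite -addn1 PoszD addrAC addrK.
Qed.

Lemma nverts_sub_sub1 (r i : nat) : nverts (r%:Z - i%:Z - 1) = (r - i)%N.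
Proof.
have [ir|ri] := leqP i r; first by rewrite subzn // nverts_sub1.
rewrite (eqP (ltnW ri)) -(subnKC ri) addSnnS PoszD opprD addrA subrr sub0r.
by rewrite -opprD.
Qed.

Definition hom_to G p : {linear path_homology G p
    -> homology (path_complex G) (nverts p)} :=
  match p return {linear path_homology G p
      -> homology (path_complex G) (nverts p)} with
  | Posz _ => lin_id _
  | Negz 0 => lin_id _
  | Negz _.+1 => \0
  end.

Definition hom_from G p : {linear homology (path_complex G) (nverts p)
    -> path_homology G p} :=
  match p return {linear homology (path_complex G) (nverts p)
      -> path_homology G p} with
  | Posz _ => lin_id _
  | Negz 0 => lin_id _
  | Negz _.+1 => \0
  end.

Lemma hom_toK G p x : hom_from G p (hom_to G p x) = x.
Proof. by case: p x => [n|[|n]] x //=; apply/rowP => -[]. Qed.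

Lemma hom_fromK G p x : (0 <= p + 1)%R -> hom_to G p (hom_from G p x) = x.
Proof. by case: p x => [n|[|n]]. Qed.

Lemma path_homology_out G p (x : path_homology G p) : ~~ (0 <= p + 1)%R -> x = 0.
Proof. by case: p x => [n|[|n]] x // _; apply/rowP => -[]. Qed.

Lemma hom_to_nat G1 G2 (f : wdigraph_map G1 G2) p x :
  homology_map (path_complex_map f) (nverts p) (hom_to G1 p x)
  = hom_to G2 p (path_homology_map f p x).
Proof.
case: p x => [n|[|n]] x //.
exact: (linear0 (homology_map (path_complex_map f) 0)).
Qed.

Lemma hom_from_nat G1 G2 (f : wdigraph_map G1 G2) p x :
  path_homology_map f p (hom_from G1 p x)
  = hom_from G2 p (homology_map (path_complex_map f) (nverts p) x).
Proof. by case: p x => [n|[|n]]. Qed.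
End Degrees.
Arguments hom_to : simpl never.
Arguments hom_from : simpl never.

(** * The Kunneth sequence of a join *)

Section Assembly.
Variables (R : idomainType) (R_pid : principal_ideal_domain R) (r : nat).
Implicit Types G : wdigraph R.

Local Notation dl i := ((i : nat)%:Z - 1).
Local Notation dr i := (r%:Z - (i : nat)%:Z).

Section Pair.
Variables (G G' : wdigraph R).
Local Notation C := (path_complex G).
Local Notation C' := (path_complex G').
Local Notation E := (path_complex (join G G')).
Variables (K : tot_data C C' E) (S : cx_split C) (S' : cx_split C').

(** In numbers of vertices the degrees i - 1 and r - i become i and r + 1 - i, with sum r + 1, the
    number of vertices of an r-path. *)
Definition alpha_sum_fun (x : tensor_sum r G G') : path_homology (join G G') (Posz r) :=
  \sum_(i < r.+2) alpha K (nverts (dl i)) (nverts (dr i)) r.+1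
    (tensor_map (hom_to G (dl i)) (hom_to G' (dr i)) (x i)).

Fact alpha_sum_linear : linear alpha_sum_fun.
Proof.
move=> a x y; rewrite /alpha_sum_fun scaler_sumr -big_split.
apply: eq_bigr => i _.
by rewrite !ffunE (linearP (tensor_map _ _)) (linearP (alpha _ _ _ _)).
Qed.

Definition alpha_sum :
    {linear tensor_sum r G G' -> path_homology (join G G') (Posz r)} :=
  linmap alpha_sum_linear.

Definition gamma_sum_fun (y : path_homology (join G G') (Posz r)) :
    tensor_sum r G G' :=
  [ffun i : 'I_r.+2 => tensor_map (hom_from G (dl i)) (hom_from G' (dr i))
    (gamma K S S' (nverts (dl i)) (nverts (dr i)) r.+1 y)].

Fact gamma_sum_linear : linear gamma_sum_fun.
Proof.
move=> a x y; apply/ffunP => i; rewrite !ffunE.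
by rewrite (linearP (gamma _ _ _ _ _ _)) (linearP (tensor_map _ _)).
Qed.

Definition gamma_sum :
    {linear path_homology (join G G') (Posz r) -> tensor_sum r G G'} :=
  linmap gamma_sum_linear.

Definition beta_sum_fun (y : path_homology (join G G') (Posz r)) : tor_sum r G G' :=
  [ffun i : 'I_r.+2 => Tor_map (hom_from G (dl i)) (hom_from G' (dr i - 1))
    (beta K S S' (nverts (dl i)) (nverts (dr i - 1)) r y)].

Fact beta_sum_linear : linear beta_sum_fun.
Proof.
move=> a x y; apply/ffunP => i; rewrite !ffunE.
by rewrite (linearP (beta _ _ _ _ _ _)) (linearP (Tor_map _ _)).
Qed.

Definition beta_sum :
    {linear path_homology (join G G') (Posz r) -> tor_sum r G G'} :=
  linmap beta_sum_linear.

Lemma gamma_alpha_sum x : gamma_sum (alpha_sum x) = x.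
Proof.
apply/ffunP => j; rewrite ffunE.
rewrite -[alpha_sum x]/(alpha_sum_fun x) /alpha_sum_fun !linear_sum.
rewrite (big_only1 j) // => [|i ij _]; last first.
  rewrite gamma_orth ?linear0 //; rewrite !nverts_sub1 => ji.
  by case/eqP: ij; apply: val_inj.
rewrite gammaK; last first.
  have jr : (j <= r.+1)%N by rewrite -ltnS.
  by rewrite nverts_sub1 nverts_sub ?subnKC.
by rewrite tensor_map_comp tensor_map_id // => h; apply: hom_toK.
Qed.

Lemma beta_alpha_sum x : beta_sum (alpha_sum x) = 0.
Proof.
apply/ffunP => j; rewrite !ffunE.
rewrite -[alpha_sum x]/(alpha_sum_fun x) /alpha_sum_fun !linear_sum big1 // => i _.
by rewrite beta_alpha linear0.
Qed.

Let Cs n : separated (chains C n). Proof. exact: Omega_separated. Qed.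
Let Cs' n : separated (chains C' n). Proof. exact: Omega_separated. Qed.

Lemma dr_ge0 (i : nat) : (i <= r)%N -> (0 <= dr i - 1 + 1)%R.
Proof. by move=> ir; rewrite subrK subzn. Qed.

Lemma dl_ge0 (i : nat) : (0 <= dl i + 1)%R.
Proof. by rewrite subrK. Qed.

Lemma beta_sum_ker y : beta_sum y = 0 -> alpha_sum (gamma_sum y) = y.
Proof.
move=> by0; have b0 (i : 'I_r.+2) : (i <= r)%N -> beta K S S' i (r - i) r y = 0.
  move=> ir; have /ffunP/(_ i) := by0; rewrite !ffunE.
  move/(congr1 (Tor_map (hom_to G (dl i)) (hom_to G' (dr i - 1)))).
  rewrite linear0 Tor_map_comp_id; first last.
  - by move=> h; apply/hom_fromK/dr_ge0.
  - by move=> h; apply/hom_fromK/dl_ge0.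
  by rewrite nverts_sub1 nverts_sub_sub1.
rewrite [RHS](beta_kernel (K := K) R_pid Cs Cs' (SC := S) (SD := S')); last first.
  move=> a b abr; have ar : (a <= r)%N by rewrite -abr leq_addr.
  have ar2 : (a < r.+2)%N by rewrite ltnS leqW.
  by rewrite -[b](addKn a) abr; apply: (b0 (Ordinal ar2)).
rewrite -[alpha_sum _]/(alpha_sum_fun _) /alpha_sum_fun; apply: eq_bigr => i _.
rewrite ffunE tensor_map_comp tensor_map_id.
- by rewrite nverts_sub1 nverts_sub // -ltnS ltn_ord.
- by move=> h; apply/hom_fromK/dl_ge0.
- move=> h; apply: hom_fromK; rewrite addrC addrA [1 + _]addrC -PoszD addn1 subzn //.
  by rewrite -ltnS ltn_ord.
Qed.

Lemma beta_sum_surj t : exists y, beta_sum y = t.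
Proof.
have h (i : 'I_r.+2) : exists y : homology E r.+1, forall j : 'I_r.+2,
    beta_sum y j = if i == j then t j else 0.
  (* The index i = r + 1 belongs to degree -2 of [G'], where the homology and hence [Tor] is
     zero. *)
  have [ir|ri] := leqP i r; last first.
    exists 0 => j; rewrite linear0 ffunE; case: eqP => // <-.
    apply/esym/Tor_trivial => z; apply: path_homology_out.
    by rewrite subrK -ltNge subr_lt0.
  have [|y [y1 y2]] := @beta_surj R C C' E K R_pid Cs S S' r
      (nverts (dl i)) (nverts (dr i - 1))
      (Tor_map (hom_to G (dl i)) (hom_to G' (dr i - 1)) (t i)).
    by rewrite nverts_sub1 nverts_sub_sub1 subnKC.
  exists y => j; rewrite ffunE; case: eqP => [<-|ij].
    rewrite y1 Tor_map_comp_id // => z; exact: hom_toK.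
  rewrite y2 ?linear0 // !nverts_sub1 => ji; case: ij; exact/esym/val_inj.
have [y yE] := fin_all_exists h; exists (\sum_i y i).
apply/ffunP => j; rewrite linear_sum /=.
have ev : linear (fun t : tor_sum r G G' => t j).
  by move=> a u v; rewrite !ffunE.
have -> : (\sum_i beta_sum (y i)) j = \sum_i beta_sum (y i) j.
  exact: (linear_sum (linmap ev)).
by rewrite (big_only1 j) // => [|i ij _]; rewrite yE ?eqxx ?(negPf ij).
Qed.

Lemma kunneth_exact : short_exact alpha_sum beta_sum /\ splits beta_sum.
Proof.
split; first split.
- exact: can_inj gamma_alpha_sum.
- move=> y; split=> [/beta_sum_ker <-|[x <-]]; last exact: beta_alpha_sum.
  by exists (gamma_sum y).
- exact: beta_sum_surj.
have /choice[s0 s0E] := beta_sum_surj.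
(* [s0] is an arbitrary choice of preimages. The correction lands in the kernel of [gamma_sum],
   where [beta_sum] is injective; uniqueness of preimages there makes [s] linear. *)
pose s z := s0 z - alpha_sum (gamma_sum (s0 z)).
have sE z : beta_sum (s z) = z by rewrite linearB s0E beta_alpha_sum subr0.
have gs z : gamma_sum (s z) = 0 by rewrite linearB gamma_alpha_sum subrr.
have inj y : beta_sum y = 0 -> gamma_sum y = 0 -> y = 0.
  by move=> /beta_sum_ker yE gy; rewrite -yE gy linear0.
have sl : linear s.
  move=> a u v; apply/eqP; rewrite -subr_eq0; apply/eqP/inj.
    by rewrite linearB linearP !sE subrr.
  by rewrite linearB linearP !gs scaler0 addr0 subrr.
by exists (linmap sl).
Qed.
End Pair.

Section Naturality.
Variables (G1 G2 G1' G2' : wdigraph R).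
Variables (f : wdigraph_map G1 G2) (f' : wdigraph_map G1' G2').
Variables (K1 : tot_data (path_complex G1) (path_complex G1')
                         (path_complex (join G1 G1')))
          (K2 : tot_data (path_complex G2) (path_complex G2')
                         (path_complex (join G2 G2'))).
Hypotheses (K1E : tm K1 = Omega_join G1 G1') (K2E : tm K2 = Omega_join G2 G2').
Variables (S1 : cx_split (path_complex G1)) (S1' : cx_split (path_complex G1'))
  (S2 : cx_split (path_complex G2)) (S2' : cx_split (path_complex G2')).

Let tm_nat a b n z : chain_map_fun (path_complex_map (join_map f f')) n (tm K1 a b n z)
  = tm K2 a b n (tensor_map (chain_map_fun (path_complex_map f) a)
                            (chain_map_fun (path_complex_map f') b) z).
Proof. by rewrite K1E K2E; apply: Omega_join_nat. Qed.

Lemma alpha_sum_nat x : path_homology_map (join_map f f') (Posz r) (alpha_sum K1 x)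
  = alpha_sum K2 (tensor_sum_map r f f' x).
Proof.
rewrite -[alpha_sum K1 x]/(alpha_sum_fun K1 x) -[RHS]/(alpha_sum_fun K2 _).
rewrite /alpha_sum_fun linear_sum; apply: eq_bigr => i _.
rewrite -[LHS]/(homology_map (path_complex_map (join_map f f')) r.+1 _).
rewrite (alpha_nat tm_nat) ffunE; congr (alpha _ _ _ _ _).
by apply: tensor_map_square => h; apply: hom_to_nat.
Qed.

Lemma beta_sum_nat y : tor_sum_map r f f' (beta_sum K1 S1 S1' y)
  = beta_sum K2 S2 S2' (path_homology_map (join_map f f') (Posz r) y).
Proof.
apply/ffunP => i; rewrite !ffunE.
rewrite -[path_homology_map _ (Posz r) y]/(homology_map
  (path_complex_map (join_map f f')) r.+1 y).
rewrite (beta_nat tm_nat R_pid _ _ S1 S2 S1' S2'); first last.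
- by move=> n; apply: Omega_separated.
- by move=> n; apply: Omega_separated.
by apply: Tor_map_square => h; apply: hom_from_nat.
Qed.
End Naturality.
End Assembly.

Theorem theorem5p3 (R : idomainType) (R_pid : principal_ideal_domain R) (r : nat) :
  exists (alpha : forall G G' : wdigraph R,
            {linear tensor_sum r G G' -> path_homology (join G G') (Posz r)})
         (beta : forall G G' : wdigraph R,
            {linear path_homology (join G G') (Posz r) -> tor_sum r G G'}),
    (forall G G' : wdigraph R, nonvanishing G -> nonvanishing G' ->
       short_exact (alpha G G') (beta G G') /\ splits (beta G G'))
    /\
    (forall (G1 G2 G1' G2' : wdigraph R)
            (f : wdigraph_map G1 G2) (f' : wdigraph_map G1' G2'),
       nonvanishing G1 -> nonvanishing G2 ->
       nonvanishing G1' -> nonvanishing G2' ->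
       (forall x, path_homology_map (join_map f f') (Posz r) (alpha G1 G1' x)
                  = alpha G2 G2' (tensor_sum_map r f f' x))
       /\
       (forall y, tor_sum_map r f f' (beta G1 G1' y)
                  = beta G2 G2' (path_homology_map (join_map f f') (Posz r) y))).
Proof.
have hs (G : wdigraph R) : inhabited (cx_split (path_complex G)).
  by apply: cx_split_exists => // n; apply: Omega_separated.
have hK (G G' : wdigraph R) : inhabited {K : tot_data (path_complex G)
    (path_complex G') (path_complex (join G G')) | tm K = Omega_join G G'}.
  pose p (H : wdigraph R) n := cid (Omega_retraction_exists H n R_pid).
  exact: (Omega_tot_data (p := fun n => sval (p G n)) (p' := fun n => sval (p G' n))
    (fun n => svalP (p G n)) (fun n => svalP (p G' n))).
(* The splittings are chosen for each digraph separately; [beta_sum_nat] holds for any such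
   choice. *)
pose S G := inhabited_witness (hs G).
pose K G G' := inhabited_witness (hK G G').
exists (fun G G' => alpha_sum r (sval (K G G'))).
exists (fun G G' => beta_sum r (sval (K G G')) (S G) (S G')).
split=> [G G' _ _|G1 G2 G1' G2' f f' _ _ _ _]; first exact: kunneth_exact.
split=> [x|y].
  exact: (alpha_sum_nat f f' (svalP (K G1 G1')) (svalP (K G2 G2'))).
exact: (beta_sum_nat R_pid f f' (svalP (K G1 G1')) (svalP (K G2 G2'))).
Qed.
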